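(* Let $T$ be a rooted tree, let $\alpha,\sigma:T\to[0,\infty)$ be weights with $\sigma$ non-increasing, let $X=(X_t)_{t\in T}$ be the Gaussian process $X_t=\sigma(t)\sum_{v\preceq t}\alpha(v)\xi_v$, and let $d$ be the metric on $T$ generated by $\alpha$ and $\sigma$ (defined in the context). If $$\int_0^\infty\sqrt{\log N(T,d,\varepsilon)}\,d\varepsilon<\infty,$$ then $X$ is a.s. bounded. Conversely, if $X$ is a.s. bounded, then necessarily $$\sup_{\varepsilon>0}\varepsilon\sqrt{\log N(T,d,\varepsilon)}<\infty.$$
   Context: $T$ is a finite or infinite tree with a unique root $\mathbf 0$; each element has a finite number (possibly zero) of offspring. The partial order is: $t\preceq s$ (equivalently $s\succeq t$) iff there are $t=t_0,t_1,\dots,t_m=s$ in $T$ with $t_j$ an offspring of $t_{j-1}$ for $1\le j\le m$; that is, $t$ lies on the branch connecting $\mathbf 0$ with $s$. $t\prec s$ means $t\preceq s$ and $t\ne s$. $t\wedge s$ is the infimum of $t$ and $s$ in this order. $\sigma$ non-increasing means $\sigma(t)\ge\sigma(s)$ whenever $t\preceq s$. $(\xi_v)_{v\in T}$ are i.i.d. standard normal random variables. $X$ is a.s. bounded means $\mathbb P(\sup_{t\in T}|X_t|<\infty)=1$. The metric $d$: for $t\preceq s$, $$d(t,s)=d(s,t):=\max_{t\prec r\preceq s}\sigma(r)\Big(\sum_{t\prec v\preceq r}\alpha(v)^2\Big)^{1/2}$$ (with $d(t,t)=0$), and $d(t,s):=d(t\wedge s,t)+d(t\wedge s,s)$ if $t$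 and $s$ are not comparable. $N(T,d,\varepsilon):=\inf\{n\ge1: T=\bigcup_{j=1}^n B_\varepsilon(t_j)\text{ for some }t_1,\dots,t_n\in T\}$, where $B_\varepsilon(t)$ is the open $\varepsilon$-ball around $t$ with respect to $d$ (the value is $+\infty$ if no such $n$ exists). *)

(* Defs.v *)
From HB Require Import structures.
From mathcomp Require Import all_boot all_order all_algebra.
From mathcomp Require Import finmap.
From mathcomp Require Import all_classical all_reals all_analysis.

Set Implicit Arguments.
Unset Strict Implicit.
Unset Printing Implicit Defensive.

Import Order.TTheory GRing.Theory Num.Theory.

Local Open Scope classical_set_scope.
Local Open Scope ring_scope.

(* [offspring t s] reads "s is an offspring of t".  The unique-parent axioms
   together with reachability from the root exclude cycles. *)
Structure rootedTree := RootedTree {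
  vertex :> choiceType;
  tree_root : vertex;
  offspring : rel vertex;
  root_no_parent : forall t, ~~ offspring t tree_root;
  unique_parent : forall t t' s, offspring t s -> offspring t' s -> t = t';
  reachable_from_root :
    forall s, exists2 p, path offspring tree_root p & last tree_root p = s;
  finitely_many_offspring : forall t, finite_set [set s | offspring t s]
}.

Section TreeOrder.
Variable T : rootedTree.
Implicit Types t s r : T.

(* The chain is t = t_0, t_1, ..., t_m = s with t :: p = [:: t_0; ...; t_m]. *)
Definition tree_le t s : Prop :=
  exists2 p, path (@offspring T) t p & last t p = s.

Definition tree_lt t s : Prop := tree_le t s /\ t <> s.

Definition is_tree_inf t s r : Prop :=
  [/\ tree_le r t, tree_le r s &
      forall r', tree_le r' t -> tree_le r' s -> tree_le r' r].

(* The infimum always exists in a rooted tree; the root is only the default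
   value required by [xget]. *)
Definition tree_meet t s : T := xget (tree_root T) (is_tree_inf t s).

End TreeOrder.

Section TreeMetric.
Variables (R : realType) (T : rootedTree) (alpha sigma : T -> R).
Implicit Types t s r v : T.

Definition sigma_nonincreasing : Prop :=
  forall t s, tree_le t s -> sigma s <= sigma t.

(* Intended for t below s.  Branches are finite, so [sup] is a maximum over a
   finite set, except for t = s where it is [sup set0 = 0]; the inner sum also
   has a finite index set. *)
Definition branch_dist t s : R :=
  sup [set sigma r *
           Num.sqrt (\sum_(v \in [set v | tree_lt t v /\ tree_le v r])
                       alpha v ^+ 2)
      | r in [set r | tree_lt t r /\ tree_le r s]].

Definition tree_dist t s : R :=
  if `[< tree_le t s >] then branch_dist t s
  else if `[< tree_le s t >] then branch_dist s t
  else branch_dist (tree_meet t s) t + branch_dist (tree_meet t s) s.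

End TreeMetric.

(* The infimum of the empty set is +oo. *)
Definition covering_number (R : realType) (T : Type) (dist : T -> T -> R)
    (eps : R) : \bar R :=
  ereal_inf [set (n%:R)%:E | n in [set n : nat | (1 <= n)%N /\
    exists c : 'I_n -> T,
      [set: T] = \bigcup_(j in [set: 'I_n]) [set s | dist (c j) s < eps]]].

Section Process.
Context (R : realType) (d : measure_display) (Omega : measurableType d).
Variable P : probability Omega R.

Definition mutually_independent (I : choiceType) (Y : I -> {RV P >-> R}) :
    Prop :=
  forall (J : {fset I}) (A : I -> set R),
    (forall i, i \in J -> measurable (A i)) ->
    P (\bigcap_(i in [set` J]) (Y i @^-1` A i)) =
    (\prod_(i <- J) P (Y i @^-1` A i))%E.

(* The second parameter of [normal_prob] is the standard deviation. *)
Definition iid_standard_normal (I : choiceType) (Y : I -> {RV P >-> R}) :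
    Prop :=
  mutually_independent Y /\
  forall (i : I) (A : set R), measurable A ->
    distribution P (Y i) A = normal_prob 0 1 A.

Definition tree_process (T : rootedTree) (alpha sigma : T -> R)
    (xi : T -> {RV P >-> R}) (t : T) (w : Omega) : R :=
  sigma t * \sum_(v \in [set v | tree_le v t]) alpha v * xi v w.

Definition as_bounded (T : Type) (X : T -> Omega -> R) : Prop :=
  P [set w | (ereal_sup [set (`|X t w|)%:E | t in [set: T]] < +oo)%E] = 1%E.

End Process.

(* Main.v *)
(* Both directions come from splitting sigma(s) S_s, where S is the alpha-weighted
   sum along a branch, at an ancestor t of s: since sigma decreases, the part up
   to t is at most |X_t|, and the rest is a centred Gaussian whose standard
   deviation is at most d(t,s).

   Sufficiency is chaining along branches.  An eps-net may be replaced by one of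
   the same size in which every s has an ancestor at distance less than 2 eps.
   Let t_k be the ancestor closest to t in the union of the nets for 1, ..., 2^-k.
   Then t_k depends on t_(k+1) only, so |X_t| is at most |X_(t_0)| plus a sum of
   Gaussians of standard deviations O(2^-k), each of which ranges over at most
   (k+2) N(2^-(k+1)) variables; the chain carries all the weight of t after
   finitely many steps.

   Necessity needs no comparison inequality.  For points a_i that are
   2 eps-separated, cut from each branch a minimal end segment (e_i,a_i] with
   d(e_i,a_i) >= eps: these segments are pairwise disjoint, so they carry
   independent Gaussians of standard deviation at least eps, all of which are at
   most 2 sup |X| in absolute value. *)

Require Import Defs.
From HB Require Import structures.
From mathcomp Require Import all_boot all_order all_algebra.
From mathcomp Require Import finmap.
From mathcomp Require Import all_classical all_reals all_analysis.
From mathcomp Require Import measurable_realfun.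
From mathcomp Require Import ring lra.

Set Implicit Arguments.
Unset Strict Implicit.
Unset Printing Implicit Defensive.

Import Order.TTheory GRing.Theory Num.Theory.

Local Open Scope classical_set_scope.
Local Open Scope ring_scope.

(** * The tree order through root paths: chains, infima, countability *)

Lemma prefix_size_eq (U : eqType) (s1 s2 : seq U) :
  prefix s1 s2 -> (size s2 <= size s1)%N -> s1 = s2.
Proof. by rewrite prefixE => /eqP e h; rewrite -e take_oversize. Qed.

Section TreeOrderTheory.
Variable T : rootedTree.
Implicit Types (t s r v : T) (p q : seq T).

(** Induction on the last vertices: equal endpoints have equal parents, and the root, having none,
    cannot end a nonempty path. *)
Lemma root_path_inj p q :
  path (@offspring T) (tree_root T) p -> path (@offspring T) (tree_root T) q ->
  last (tree_root T) p = last (tree_root T) q -> p = q.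
Proof.
elim/last_ind: p q => [|p x IH] q; case/lastP: q => [|q y] //=.
- rewrite rcons_path last_rcons => _ /andP[_ h] e.
  by move: h; rewrite -e (negbTE (root_no_parent _)).
- rewrite rcons_path last_rcons => /andP[_ h] _ e.
  by move: h; rewrite e (negbTE (root_no_parent _)).
- rewrite !rcons_path !last_rcons => /andP[pp hp] /andP[pq hq] xy.
  rewrite -xy in hq *.
  by rewrite (IH _ pp pq (unique_parent hp hq)).
Qed.

(** The path is chosen, but [root_path_inj] makes it unique. *)
Definition root_path s : seq T := sval (cid2 (reachable_from_root s)).

Lemma root_pathP s : path (@offspring T) (tree_root T) (root_path s).
Proof. by rewrite /root_path; case: cid2. Qed.

Lemma last_root_path s : last (tree_root T) (root_path s) = s.
Proof. by rewrite /root_path; case: cid2. Qed.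

(* Coding a vertex by its path from the root turns the tree order into the
   prefix order on sequences. *)
Lemma tree_leE t s : tree_le t s <-> prefix (root_path t) (root_path s).
Proof.
split=> [[p pt ls]|/prefixP[p ep]].
  apply/prefixP; exists p; apply: root_path_inj.
  - exact: root_pathP.
  - by rewrite cat_path root_pathP last_root_path.
  - by rewrite last_cat !last_root_path.
have := root_pathP s; have := last_root_path s.
rewrite ep cat_path last_cat last_root_path => ls /andP[_ pt].
by exists p.
Qed.

Lemma tree_le_refl t : tree_le t t.
Proof. by exists [::]. Qed.

Lemma tree_le_trans t s r : tree_le t s -> tree_le s r -> tree_le t r.
Proof. by rewrite !tree_leE; exact: prefix_trans. Qed.

Lemma root_le t : tree_le (tree_root T) t.
Proof.
apply/tree_leE; suff -> : root_path (tree_root T) = [::] by exact: prefix0s.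
apply: root_path_inj => //; first exact: root_pathP.
by rewrite last_root_path.
Qed.

Lemma tree_le_size t s : tree_le t s -> (size (root_path t) <= size (root_path s))%N.
Proof. by move/tree_leE; exact: size_prefix. Qed.

Lemma tree_le_size_eq t s :
  tree_le t s -> (size (root_path s) <= size (root_path t))%N -> t = s.
Proof.
move=> /tree_leE p h; rewrite -(last_root_path t) -(last_root_path s).
by rewrite (prefix_size_eq p h).
Qed.

Lemma tree_le_anti t s : tree_le t s -> tree_le s t -> t = s.
Proof. by move=> h /tree_le_size; exact: tree_le_size_eq. Qed.

Lemma tree_le_chain t s r : tree_le t r -> tree_le s r -> tree_le t s \/ tree_le s t.
Proof.
rewrite !tree_leE !prefixE => /eqP et /eqP es.
have [le|/ltnW le] := leqP (size (root_path t)) (size (root_path s)).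
  by left; rewrite -es take_takel// et.
by right; rewrite -et take_takel// es.
Qed.

Lemma tree_leVlt t s r : tree_le t r -> tree_le s r -> tree_le t s \/ tree_lt s t.
Proof.
move=> tr sr; have [ts|st] := tree_le_chain tr sr; first by left.
have [<-|ne] := pselect (s = t); first by left; exact: tree_le_refl.
by right.
Qed.

Lemma tree_le_lt_trans t s r : tree_le t s -> tree_lt s r -> tree_lt t r.
Proof.
move=> ts [sr ne]; split; first exact: tree_le_trans sr.
by move=> tr; apply: ne; apply: tree_le_anti => //; rewrite -tr.
Qed.

Lemma tree_lt_le_false t s : tree_lt t s -> ~ tree_le s t.
Proof. by move=> [ts ne] st; apply: ne; exact: tree_le_anti. Qed.

Lemma finite_tree_le s : finite_set [set v | tree_le v s].
Proof.
apply: (@sub_finite_set _ _ [set` tree_root T :: root_path s]); last exact: finite_seq.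
move=> v /= /tree_leE /prefixP[p e].
rewrite -(last_root_path v) e -cat_cons.
by rewrite mem_cat mem_last.
Qed.

(** The candidates lie on one branch, where the length of [root_path] determines the vertex, so a
    longest candidate dominates the others. *)
Lemma exists_tree_max (Q : T -> Prop) s v : (forall t, Q t -> tree_le t s) -> Q v ->
  exists2 m, Q m & forall t, Q t -> tree_le t m.
Proof.
move=> Qs Qv.
pose q n := `[< exists2 t, Q t & size (root_path t) = n >].
have qex : exists n, q n by exists (size (root_path v)); apply/asboolP; exists v.
have qub n : q n -> (n <= size (root_path s))%N.
  by move=> /asboolP[t Qt <-]; exact/tree_le_size/Qs.
case: (ex_maxnP qex qub) => n /asboolP[m Qm mn] nmax; exists m => // t Qt.
have [//|mt] := tree_le_chain (Qs _ Qt) (Qs _ Qm).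
rewrite (tree_le_size_eq mt) ?mn; first exact: tree_le_refl.
by apply: nmax; apply/asboolP; exists t.
Qed.

Lemma exists_tree_min (Q : T -> Prop) s v : (forall t, Q t -> tree_le t s) -> Q v ->
  exists2 m, Q m & forall t, Q t -> tree_le m t.
Proof.
move=> Qs Qv.
pose q n := `[< exists2 t, Q t & size (root_path t) = n >].
have qex : exists n, q n by exists (size (root_path v)); apply/asboolP; exists v.
case: (ex_minnP qex) => n /asboolP[m Qm mn] nmin; exists m => // t Qt.
have [//|tm] := tree_le_chain (Qs _ Qm) (Qs _ Qt).
rewrite (tree_le_size_eq tm) ?mn; first exact: tree_le_refl.
by apply: nmin; apply/asboolP; exists t.
Qed.

Lemma tree_meetP t s : is_tree_inf t s (tree_meet t s).
Proof.
rewrite /tree_meet.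
have [|m [mt ms] mmax] := @exists_tree_max (fun r => tree_le r t /\ tree_le r s) t
  (tree_root T) (fun r => @proj1 _ _); first by split; exact: root_le.
apply: (@xgetPex _ (tree_root T) (is_tree_inf t s)).
by exists m; split => // r rt rs; exact: mmax.
Qed.

Lemma tree_meet_idl t s : tree_le t s -> tree_meet t s = t.
Proof.
by move=> ts; have [mt _] := tree_meetP t s => /(_ _ (tree_le_refl t) ts);
  exact: tree_le_anti.
Qed.

Lemma tree_meet_idr t s : tree_le s t -> tree_meet t s = s.
Proof.
by move=> st; have [_ ms] := tree_meetP t s => /(_ _ st (tree_le_refl s));
  exact: tree_le_anti.
Qed.

(** Levels are finite by induction, and countably many of them exhaust the tree. Events that involve
    all vertices become measurable this way. *)
Lemma countable_tree : countable [set: T].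
Proof.
pose level n := [set t : T | size (root_path t) = n].
have root_pathS t s : offspring t s -> size (root_path s) = (size (root_path t)).+1.
  move=> ts; suff -> : root_path s = rcons (root_path t) s by rewrite size_rcons.
  apply: root_path_inj; first exact: root_pathP.
    by rewrite rcons_path root_pathP last_root_path.
  by rewrite last_root_path last_rcons.
have finl n : finite_set (level n).
  elim: n => [|n IH].
    apply: (@sub_finite_set _ _ [set tree_root T]); last exact: finite_set1.
    by move=> t /= /size0nil e; rewrite -(last_root_path t) e.
  apply: (@sub_finite_set _ _ (\bigcup_(t in level n) [set s | offspring t s])).
    rewrite /level => s /= sn; have := root_pathP s; have := last_root_path s.
    move: sn; case/lastP E : (root_path s) => [|p x] //.
    rewrite size_rcons last_rcons rcons_path => -[pn] -> /andP[_ h].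
    exists (last (tree_root T) p) => //=; rewrite /level/=.
    by apply: succn_inj; rewrite -(root_pathS _ _ h) E size_rcons pn.
  by apply: bigcup_finite => // t _; exact: finitely_many_offspring.
rewrite [X in countable X](_ : _ = \bigcup_n level n).
  by apply: bigcup_countable => // n _; exact: finite_set_countable.
by apply/seteqP; split => // t _; exists (size (root_path t)).
Qed.

End TreeOrderTheory.

(** * Finite sums and maxima over sets *)

Section FiniteSums.
Variables (R : realType) (I : choiceType).
Implicit Types (A B : set I) (F : I -> R).

Lemma finite_argmax A F : finite_set A -> A !=set0 ->
  exists2 m, A m & forall v, A v -> F v <= F m.
Proof.
move=> /finite_seqP[s ->]; elim: s => [|a s IH] [v] //= _.
have [->|[m ms mmax]] : s = [::] \/ exists2 m, m \in s & forall v, v \in s -> F v <= F m.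
  by case: s IH => [|b s] IH; [left|right; apply: IH; exists b; rewrite /= mem_head].
  by exists a; rewrite ?mem_head// => u /=; rewrite inE => /eqP ->.
have [am|/ltW ma] := leP (F a) (F m).
  exists m; first by rewrite inE ms orbT.
  by move=> u; rewrite /= inE => /orP[/eqP ->//|/mmax].
exists a; first by rewrite mem_head.
by move=> u; rewrite /= inE => /orP[/eqP ->//|/mmax /le_trans]; exact.
Qed.

Lemma fsumr_le_subset A B F : finite_set B -> A `<=` B -> (forall v, 0 <= F v) ->
  \sum_(v \in A) F v <= \sum_(v \in B) F v.
Proof.
move=> fB AB F0; rewrite [leRHS](fsbigID A)//= setIidr// lerDl.
by apply: fsumr_ge0.
Qed.

Lemma ler_fsumr A F v : finite_set A -> A v -> (forall v, 0 <= F v) ->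
  F v <= \sum_(u \in A) F u.
Proof.
move=> fA Av F0; rewrite -[leLHS](@fsbig_set1 _ _ +%R _ v F).
by apply: fsumr_le_subset => // u ->.
Qed.

Lemma sum_seq_restrict (J : seq I) A F : uniq J ->
  A `<=` [set` J] -> \sum_(v <- J) (if v \in A then F v else 0) = \sum_(v \in A) F v.
Proof.
move=> uJ AJ; rewrite fsbig_seq//= fsbig_mkcond [RHS]fsbig_mkcond; apply: eq_fsbigr => v _.
rewrite /patch; case: (boolP (v \in A)) => [/set_mem/AJ vJ|_].
  by rewrite mem_set.
by case: ifP.
Qed.

End FiniteSums.

(** * Branch segments and the splitting of sums along them *)

Section BranchSegments.
Variable T : rootedTree.
Implicit Types (t s r v m : T).

Definition branch_seg t s : set T := [set v | tree_lt t v /\ tree_le v s].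

Lemma finite_branch_seg t s : finite_set (branch_seg t s).
Proof. by apply: sub_finite_set (finite_tree_le s) => v []. Qed.

Lemma branch_seg_refl t : branch_seg t t = set0.
Proof. by apply/seteqP; split => // v [/tree_lt_le_false]. Qed.

Lemma branch_segS t t' s s' : tree_le t' t -> tree_le s s' ->
  branch_seg t s `<=` branch_seg t' s'.
Proof.
move=> tt ss v [tv vs]; split; first exact: tree_le_lt_trans tv.
exact: tree_le_trans ss.
Qed.

Variable R : realType.
Implicit Type F : T -> R.

Lemma branch_sum_split F t m s : tree_le t m -> tree_le m s ->
  \sum_(v \in branch_seg t s) F v =
  \sum_(v \in branch_seg t m) F v + \sum_(v \in branch_seg m s) F v.
Proof.
move=> tm ms; rewrite -fsbigU0; [|exact: finite_branch_seg..|]; last first.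
  by move=> v [[_ vm] [/tree_lt_le_false]].
congr (\sum_(v \in _) F v); apply/seteqP; split => [v [tv vs]|v [[tv vm]|[mv vs]]].
- by have [vm|mv] := tree_leVlt vs ms; [left|right].
- by split => //; exact: tree_le_trans ms.
- by split => //; exact: tree_le_lt_trans mv.
Qed.

Lemma ancestor_sum_split F t s : tree_le t s ->
  \sum_(v \in [set v | tree_le v s]) F v =
  \sum_(v \in [set v | tree_le v t]) F v + \sum_(v \in branch_seg t s) F v.
Proof.
move=> ts; rewrite -fsbigU0; [|exact: finite_tree_le|exact: finite_branch_seg|];
  last by move=> v [/= vt [/tree_lt_le_false]].
congr (\sum_(v \in _) F v); apply/seteqP; split => [v /= vs|v [vt|[_ //]]].
- by have [vt|tv] := tree_leVlt vs ts; [left|right].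
- exact: tree_le_trans ts.
Qed.

End BranchSegments.

(** * The branch distance and the tree metric *)

Section TreeMetricTheory.
Variables (R : realType) (T : rootedTree) (alpha sigma : T -> R).
Hypothesis sigma_ge0 : forall t, 0 <= sigma t.
Hypothesis sigma_noninc : sigma_nonincreasing sigma.
Implicit Types (t s r v m : T) (eps : R).

Local Notation len t s := (Num.sqrt (\sum_(v \in branch_seg t s) alpha v ^+ 2)).
Local Notation bd := (branch_dist alpha sigma).

Lemma branch_len_le t t' s s' : tree_le t' t -> tree_le s s' -> len t s <= len t' s'.
Proof.
move=> tt ss; apply: ler_wsqrtr; apply: fsumr_le_subset.
- exact: finite_branch_seg.
- exact: branch_segS.
- by move=> v; exact: sqr_ge0.
Qed.

Lemma branch_dist_refl t : bd t t = 0.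
Proof.
rewrite /branch_dist -/(branch_seg t t) branch_seg_refl.
by rewrite image_set0 sup0.
Qed.

Lemma branch_dist_le t s c : 0 <= c ->
  (forall r, branch_seg t s r -> sigma r * len t r <= c) -> bd t s <= c.
Proof.
move=> c0 h; rewrite /branch_dist -/(branch_seg t s).
have [->|/set0P[r rs]] := eqVneq (branch_seg t s) set0.
  by rewrite image_set0 sup0.
apply: ge_sup; first by exists (sigma r * len t r), r.
by move=> _ [u us <-]; exact: h.
Qed.

Lemma branch_dist_ge t s r : branch_seg t s r -> sigma r * len t r <= bd t s.
Proof.
move=> rs; apply: ub_le_sup; last by exists r.
exists (sigma t * len t s) => _ [u [[tu _] us] <-].
by apply: ler_pM; rewrite ?sqrtr_ge0 ?sigma_noninc ?branch_len_le//; exact: tree_le_refl.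
Qed.

Lemma branch_dist_ge_end t s : tree_le t s -> sigma s * len t s <= bd t s.
Proof.
move=> ts; have [<-|ne] := pselect (t = s).
  by rewrite branch_seg_refl fsbig_set0 sqrtr0 mulr0 branch_dist_refl.
by apply: branch_dist_ge; split => //; exact: tree_le_refl.
Qed.

Lemma branch_dist_ge0 t s : 0 <= bd t s.
Proof.
have [e|/set0P[r rs]] := eqVneq (branch_seg t s) set0.
  by rewrite /branch_dist -/(branch_seg t s) e image_set0 sup0.
by apply: le_trans (branch_dist_ge rs); rewrite mulr_ge0 ?sqrtr_ge0.
Qed.

(** The supremum runs over a finite set; [0 < eps] rules out the empty segment, where it has the
    default value 0. *)
Lemma branch_dist_attained t s eps : 0 < eps -> eps <= bd t s ->
  exists2 r, branch_seg t s r & eps <= sigma r * len t r.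
Proof.
move=> eps0 le; have [e|/set0P nz] := eqVneq (branch_seg t s) set0.
  move: le; rewrite /branch_dist -/(branch_seg t s) e image_set0 sup0.
  by move/(lt_le_trans eps0); rewrite ltxx.
have [r rs rmax] := finite_argmax (fun r => sigma r * len t r) (finite_branch_seg t s) nz.
exists r => //; apply: le_trans le _; apply: branch_dist_le => //.
by rewrite mulr_ge0 ?sqrtr_ge0.
Qed.

Lemma branch_distS t t' s s' : tree_le t' t -> tree_le s s' -> bd t s <= bd t' s'.
Proof.
move=> tt ss; apply: branch_dist_le; first exact: branch_dist_ge0.
move=> r rs; apply: le_trans (branch_dist_ge (branch_segS tt ss rs)).
by rewrite ler_wpM2l// branch_len_le//; exact: tree_le_refl.
Qed.

(** A vertex [r] up to [m] is already counted in the first term. Beyond [m], the sum is split at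
    [m], the square root is subadditive, and [sigma r <= sigma m] bounds the first part. *)
Lemma branch_dist_triangle t m s : tree_le t m -> tree_le m s ->
  bd t s <= bd t m + bd m s.
Proof.
move=> tm ms; apply: branch_dist_le; first by rewrite addr_ge0 ?branch_dist_ge0.
move=> r [tr rs]; have [rm|mr] := tree_leVlt rs ms.
  apply: (@le_trans _ _ (bd t m)); last by rewrite lerDl branch_dist_ge0.
  exact: branch_dist_ge.
have mr' := mr.1.
apply: (@le_trans _ _ (sigma m * len t m + sigma r * len m r)); last first.
  by apply: lerD; [exact: branch_dist_ge_end|exact: branch_dist_ge].
apply: (@le_trans _ _ (sigma r * (len t m + len m r))); last first.
  by rewrite mulrDr lerD2r ler_wpM2r ?sqrtr_ge0// sigma_noninc.
rewrite ler_wpM2l// (branch_sum_split _ tm mr').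
set a := (X in X + _); set b := (X in _ + X).
have a0 : 0 <= a by apply: fsumr_ge0 => v _; exact: sqr_ge0.
have b0 : 0 <= b by apply: fsumr_ge0 => v _; exact: sqr_ge0.
rewrite -[leRHS]ger0_norm ?addr_ge0 ?sqrtr_ge0// -sqrtr_sqr ler_wsqrtr//.
rewrite sqrrD !sqr_sqrtr//.
by rewrite addrAC lerDl mulrn_wge0// mulr_ge0 ?sqrtr_ge0.
Qed.

(** As [branch_dist] vanishes at coinciding endpoints, the formula for incomparable vertices covers
    the comparable ones too. *)
Lemma tree_distE t s :
  tree_dist alpha sigma t s = bd (tree_meet t s) t + bd (tree_meet t s) s.
Proof.
rewrite /tree_dist; case: asboolP => [ts|_].
  by rewrite tree_meet_idl// branch_dist_refl add0r.
case: asboolP => [st|//].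
by rewrite tree_meet_idr// branch_dist_refl addr0.
Qed.

Lemma tree_dist_ge0 t s : 0 <= tree_dist alpha sigma t s.
Proof. by rewrite tree_distE addr_ge0 ?branch_dist_ge0. Qed.

(* The centre of a ball is replaced by its ancestor closest to the root among
   those at distance less than eps from it. *)
Lemma order_net n eps (c : 'I_n -> T) :
  (forall s, exists i, tree_dist alpha sigma (c i) s < eps) ->
  exists c' : 'I_n -> T, forall s, exists2 i, tree_le (c' i) s & bd (c' i) s < 2 * eps.
Proof.
move=> cov.
have eps0 : 0 < eps.
  by have [i /(le_lt_trans (tree_dist_ge0 _ _))] := cov (tree_root T).
pose Q t r := tree_le r t /\ bd r t < eps.
have low t : {r | Q t r & forall r', Q t r' -> tree_le r r'}.
  apply: cid2; apply: (@exists_tree_min _ (Q t) t t) => [r []//|].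
  by split; [exact: tree_le_refl|rewrite branch_dist_refl].
exists (fun i => s2val (low (c i))) => s.
have [i] := cov s; rewrite tree_distE => p; exists i.
  case: (low (c i)) => l /= [lc lcl] lmin.
  have [mc ms _] := tree_meetP (c i) s.
  apply: tree_le_trans ms; apply: lmin; split => //.
  by apply: le_lt_trans p; rewrite lerDl branch_dist_ge0.
case: (low (c i)) => l /= [lc lcl] lmin.
have [mc ms _] := tree_meetP (c i) s.
have lm : tree_le l (tree_meet (c i) s).
  by apply: lmin; split => //; apply: le_lt_trans p; rewrite lerDl branch_dist_ge0.
have h1 := branch_dist_triangle lm ms.
have h2 := branch_distS (tree_le_refl l) mc.
by move: (branch_dist_ge0 (tree_meet (c i) s) (c i)) => h3; lra.
Qed.

End TreeMetricTheory.

(** * Short segments, minimal long segments and their disjointness *)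

Section MetricConsequences.
Variables (R : realType) (T : rootedTree) (alpha sigma : T -> R).
Hypothesis alpha_ge0 : forall t, 0 <= alpha t.
Hypothesis sigma_ge0 : forall t, 0 <= sigma t.
Hypothesis sigma_noninc : sigma_nonincreasing sigma.
Implicit Types (t s r v e : T) (eps : R).

Local Notation len t s := (Num.sqrt (\sum_(v \in branch_seg t s) alpha v ^+ 2)).
Local Notation bd := (branch_dist alpha sigma).

(* The weights alpha above t take finitely many values, so a branch segment
   ending at t that is short enough carries no weight at all. *)
Lemma short_branch_weight0 t : exists2 delta, 0 < delta &
  forall p, tree_le p t -> bd p t < delta ->
  forall x : T -> R, sigma t * (\sum_(v \in branch_seg p t) alpha v * x v) = 0.
Proof.
have := sigma_ge0 t; rewrite le_eqVlt => /predU1P[<-|st0].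
  by exists 1 => // p _ _ x; rewrite mul0r.
have [delta d0 dP] : exists2 delta, 0 < delta &
    forall v, tree_le v t -> 0 < alpha v -> delta <= alpha v.
  pose A := [set v | tree_le v t /\ 0 < alpha v].
  have fA : finite_set A by apply: sub_finite_set (finite_tree_le t) => v [].
  have [A0|/set0P An0] := eqVneq A set0.
    exists 1 => // v vt av; suff : A v by rewrite A0.
    by split.
  have [m [_ am] mmin] := finite_argmax (fun v => - alpha v) fA An0.
  by exists (alpha m) => // v vt av; rewrite -lerN2; apply: mmin.
(* [delta] bounds the positive weights up to [t] from below; one such weight in the segment would
   force a distance of at least [sigma t * delta]. *)
exists (sigma t * delta); first by rewrite mulr_gt0.
move=> p pt short x; rewrite fsbig1 ?mulr0// => v pv.
have /eqP -> : alpha v == 0; last by rewrite mul0r.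
rewrite eq_le alpha_ge0 andbT leNgt; apply/negP => av.
have := dP v pv.2 av; apply/negP; rewrite -ltNge -(ltr_pM2l st0).
apply: le_lt_trans short; apply: le_trans (branch_dist_ge_end alpha sigma_ge0 sigma_noninc pt).
rewrite ler_pM2l// -[leLHS]ger0_norm// -sqrtr_sqr ler_wsqrtr//.
apply: (@ler_fsumr _ _ _ (fun v => alpha v ^+ 2)) => //.
  exact: finite_branch_seg.
by move=> u; exact: sqr_ge0.
Qed.

(** Take [e] as far from the root as possible with [eps <= bd e s], so that every later start gives
    less than [eps]; [r] is a vertex where the distance is attained. *)
Lemma shortest_long_branch s eps : 0 < eps -> eps <= bd (tree_root T) s ->
  exists e r, [/\ branch_seg e s r, eps <= sigma r * len e r &
    forall v, branch_seg e s v -> bd v s < eps].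
Proof.
move=> eps0 le.
have [|e [es le'] emax] := @exists_tree_max _ (fun e => tree_le e s /\ eps <= bd e s) s
  (tree_root T) (fun e => @proj1 _ _).
  by split => //; exact: root_le.
have [r er lr] := branch_dist_attained sigma_ge0 eps0 le'.
exists e, r; split => // v [ev vs]; rewrite ltNge; apply/negP => lv.
by apply: (tree_lt_le_false ev); apply: emax.
Qed.

(** A common vertex would lie below the meet of [a] and [b], so both distances from the meet would
    be less than [eps], against the separation. *)
Lemma separated_branches_disjoint a b e e' eps :
  (forall v, branch_seg e a v -> bd v a < eps) ->
  (forall v, branch_seg e' b v -> bd v b < eps) ->
  2 * eps <= tree_dist alpha sigma a b -> branch_seg e a `&` branch_seg e' b = set0.
Proof.
move=> ha hb; rewrite leNgt tree_distE => /negP ab.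
apply/seteqP; split => // v [va vb]; apply: ab.
have [_ _ /(_ v va.2 vb.2) vm] := tree_meetP a b.
have h1 := branch_distS alpha sigma_ge0 sigma_noninc vm (tree_le_refl a).
have h2 := branch_distS alpha sigma_ge0 sigma_noninc vm (tree_le_refl b).
have := ha v va; have := hb v vb; lra.
Qed.

End MetricConsequences.

(** * Covering numbers and separated points *)

Section CoveringNumber.
Variables (R : realType) (T : Type) (dist : T -> T -> R).
Implicit Types (n : nat) (eps : R).

Definition covers n eps := exists c : 'I_n -> T, forall s, exists i, dist (c i) s < eps.

Lemma covering_numberE eps : covering_number dist eps =
  ereal_inf [set n%:R%:E | n in [set n : nat | (1 <= n)%N /\ covers n eps]].
Proof.
congr (ereal_inf (image _ _)); apply/seteqP; split => n /= [n1 [c cP]]; split => //;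
    exists c.
  by move=> s; have : [set: T] s by []; rewrite cP => -[i _ /=]; exists i.
by apply/seteqP; split => // s _; have [i] := cP s; exists i.
Qed.

Lemma covering_number_le n eps : (0 < n)%N -> covers n eps ->
  (covering_number dist eps <= n%:R%:E)%E.
Proof. by move=> n0 cn; rewrite covering_numberE; apply: ereal_inf_lbound; exists n. Qed.

Lemma covering_number_ge1 eps : (1 <= covering_number dist eps)%E.
Proof.
rewrite covering_numberE; apply: le_ereal_inf_tmp => _ [n [n0 _] <-].
by rewrite lee_fin ler1n.
Qed.

(** A finite infimum means that some [n] is admissible, and the least admissible [n] attains it. *)
Lemma covering_numberP eps : (covering_number dist eps < +oo)%E ->
  exists n, [/\ (0 < n)%N, covers n eps & covering_number dist eps = n%:R%:E].
Proof.
move=> fin; pose q n := `[< (0 < n)%N /\ covers n eps >].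
have qex : exists n, q n.
  apply: contrapT => h; move: fin; rewrite covering_numberE.
  rewrite (_ : [set n : nat | _] = set0) ?image_set0 ?ereal_inf0//.
  by apply/seteqP; split => // n nP; apply: h; exists n; apply/asboolP.
case: (ex_minnP qex) => n /asboolP[n0 cn] nmin; exists n; split => //.
apply/eqP; rewrite eq_le covering_number_le//= covering_numberE.
apply: le_ereal_inf_tmp => _ [m mP <-]; rewrite lee_fin ler_nat.
by apply: nmin; apply/asboolP.
Qed.

Lemma covering_number_anti eps eps' : eps <= eps' ->
  (covering_number dist eps' <= covering_number dist eps)%E.
Proof.
move=> le; rewrite !covering_numberE; apply: ereal_inf_le_tmp.
move=> _ [n [n0 [c cP]] <-]; exists n => //; split => //; exists c => s.
by have [i ci] := cP s; exists i; exact: lt_le_trans le.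
Qed.

(** Greedy choice: at most [n] points cannot be the centres of a cover, so a further point is far
    from all of them. Prescribing [x0] later lets the root come first. *)
Lemma exists_separated (x0 : T) n eps : ~ covers n eps ->
  forall k, (k <= n)%N -> exists s : seq T, [/\ size s = k.+1, nth x0 s 0 = x0 &
    forall i j, (i < j <= k)%N -> eps <= dist (nth x0 s i) (nth x0 s j)].
Proof.
move=> ncov; elim=> [|k IH] kn.
  by exists [:: x0]; split => // i j /andP[ij]; rewrite leqn0 => /eqP j0; rewrite j0 in ij.
have [s [sk s0 sep]] := IH (ltnW kn).
have [t far] : exists t, forall i, (i <= k)%N -> eps <= dist (nth x0 s i) t.
  (* Since [k < n], these [n] centres include all [k.+1] points; surplus indices give the default
     [x0]. *)
  apply: contrapT => h; apply: ncov; exists (fun i => nth x0 s i) => t.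
  apply: contrapT => h'; apply: h; exists t => i ik.
  rewrite leNgt; apply/negP => near; apply: h'.
  by exists (Ordinal (leq_ltn_trans ik kn)).
exists (rcons s t); split; first by rewrite size_rcons sk.
  by rewrite nth_rcons sk.
move=> i j /andP[ij jk]; rewrite !nth_rcons sk.
rewrite (leq_trans ij jk); move: jk; rewrite leq_eqVlt => /predU1P[jk|jk].
  by rewrite jk ltnn eqxx far// -ltnS -jk.
by rewrite jk sep// ij -ltnS.
Qed.

End CoveringNumber.

(** * Weighted integrals, and the exponential moment of a standard Gaussian *)

Section WeightedIntegral.
Context d (Om : measurableType d) (R : realType).
Variable mu : {sigma_finite_measure set Om -> \bar R}.

(** Fubini for the weight [W] on the region [S] under the graph of [f]. The inner integrals on the
    right contain only indicators, to which hypotheses about events apply. *)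
Lemma ge0_integral_layer_cake (W f : Om -> R) :
  measurable_fun setT W -> (forall w, 0 <= W w) ->
  measurable_fun setT f -> (forall w, 0 <= f w) ->
  (\int[mu]_w (W w * f w)%:E =
   \int[lebesgue_measure]_u \int[mu]_w (W w * \1_[set w | 0 < u < f w] w)%:E)%E.
Proof.
move=> mW W0 mf f0.
pose S := [set z : Om * R | 0 < z.2 < f z.1].
have mS : measurable S.
  have mb : measurable_fun setT (fun z : Om * R => (0 < z.2) && (z.2 < f z.1)).
    apply: measurable_and; apply: measurable_fun_ltr => //.
    exact: (measurableT_comp mf).
  by have := mb measurableT [set true]; rewrite setTI; apply.
pose phi (z : Om * R) : \bar R := (W z.1 * \1_S z)%:E.
have mphi : measurable_fun setT phi.
  apply/measurable_EFinP; apply: measurable_funM; last exact: measurable_indic.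
  exact: (measurableT_comp mW).
have phi0 z : (0 <= phi z)%E by rewrite lee_fin mulr_ge0 ?W0.
have := sfinite_Fubini mu (@lebesgue_measure R) phi phi0 mphi.
have -> : (\int[mu]_w \int[lebesgue_measure]_u phi (w, u) =
          \int[mu]_w (W w * f w)%:E)%E.
  apply: eq_integral => w _.
  transitivity (\int[lebesgue_measure]_u
      ((W w)%:E * (\1_`]0, f w[%classic (u : R))%:E))%E.
    by apply: eq_integral => u _; rewrite -EFinM /phi !indicE;
      congr ((_ * (nat_of_bool _)%:R)%:E).
  rewrite ge0_integralZl//; last by rewrite lee_fin.
    rewrite EFinM; congr (_ * _)%E.
    rewrite integral_indic// setIT.
    etransitivity; first exact: (lebesgue_measure_itv `]0, f w[).
    rewrite /= lte_fin.
    by case: ltP => [_|fw]; [rewrite oppr0 adde0|apply/eqP; rewrite eqe eq_le fw f0].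
  by apply/measurable_EFinP; exact: measurable_indic.
move=> ->; apply: eq_integral => u _; apply: eq_integral => w _.
by rewrite /phi /= !indicE; congr ((_ * (nat_of_bool _)%:R)%:E).
Qed.

End WeightedIntegral.

(* Both a change of density and the independence of W and X have this form. *)
Lemma ge0_integral_weighted d (Om : measurableType d) (R : realType)
    (mu : {sigma_finite_measure set Om -> \bar R})
    (nu : {sigma_finite_measure set (measurableTypeR R) -> \bar R}) (W X : Om -> R) (c : R) :
  measurable_fun setT W -> (forall w, 0 <= W w) -> measurable_fun setT X -> 0 <= c ->
  (forall A, measurable A -> (\int[mu]_w (W w * \1_A (X w))%:E = c%:E * nu A)%E) ->
  forall f : R -> R, measurable_fun setT f -> (forall x, 0 <= f x) ->
  (\int[mu]_w (W w * f (X w))%:E = c%:E * \int[nu]_x (f x)%:E)%E.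
Proof.
move=> mW W0 mX c0 WX f mf f0.
rewrite (@ge0_integral_layer_cake _ _ _ mu W (f \o X))//; last 2 first.
- exact: (measurableT_comp mf mX).
- by move=> w; exact: f0.
rewrite -ge0_integralZl//; last 2 first.
- exact/measurable_EFinP.
- by move=> x _; rewrite lee_fin.
under [RHS]eq_integral do rewrite -EFinM.
rewrite (@ge0_integral_layer_cake _ _ _ nu (cst c) f)//.
apply: eq_integral => u _.
pose A := [set x : R | 0 < (u : R) < f x].
have mA : measurable A.
  have mb : measurable_fun setT (fun x : R => (0 < (u : R)) && ((u : R) < f x)).
    by apply: measurable_and => //; exact: measurable_fun_ltr.
  by have := mb measurableT [set true]; rewrite setTI; apply.
transitivity (c%:E * nu A)%E.
  by rewrite -WX//; apply: eq_integral => w _;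
    rewrite !indicE; congr ((_ * (nat_of_bool _)%:R)%:E).
under eq_integral do rewrite /cst/= EFinM.
rewrite ge0_integralZl//; last by apply/measurable_EFinP; exact: measurable_indic.
by rewrite integral_indic// setIT.
Qed.

(** Completing the square: [expR (c * x)] times the standard density is [expR (c ^+ 2 / 2)] times
    the normal density with mean [c]. *)
Lemma normal_mgf (R : realType) (c : R) :
  (\int[normal_prob 0 1]_x (expR (c * x))%:E = (expR (c ^+ 2 / 2))%:E)%E.
Proof.
have mE : measurable_fun setT (fun x : R => expR (c * x)).
  by apply: measurableT_comp => //; exact: measurable_funM.
have := @ge0_integral_weighted _ _ _ (@lebesgue_measure R)
  (normal_prob 0 1)
  (normal_pdf 0 1) id 1 (measurable_normal_pdf _ _) (normal_pdf_ge0 _ _) (@measurable_id _ _ _).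
move=> /(_ ler01) => h; rewrite -[LHS]mul1e -h//; last first.
  move=> A mA; rewrite mul1e /normal_prob /= [RHS]integral_mkcond.
  apply: eq_integral => x _; rewrite patchE indicE; case: ifPn => /=; rewrite ?mulr1 ?mulr0//.
rewrite -[RHS]mule1 -(integral_normal_pdf c (1 : R)) -ge0_integralZl//; last 2 first.
- by apply/measurable_EFinP; exact: measurable_normal_pdf.
- by move=> x _; rewrite lee_fin normal_pdf_ge0.
apply: eq_integral => x _; rewrite -EFinM !normal_pdfE ?oner_neq0//; congr EFin.
rewrite /normal_fun [RHS]mulrCA -mulrA -!expRD; congr (_ * expR _).
by rewrite expr1n -mulr_natr; field.
Qed.

(** * Independence and exponential moments of Gaussian sums *)

Section GaussianExponentialMoments.
Context (R : realType) (d : measure_display) (Om : measurableType d).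
Variables (P : probability Om R) (I : choiceType) (Y : I -> {RV P >-> R}).
Hypothesis Yiid : iid_standard_normal Y.

Lemma indep_indicators (s : seq I) (A : I -> set R) : uniq s ->
  (forall i, measurable (A i)) ->
  (\int[P]_w (\prod_(i <- s) \1_(A i) (Y i w))%:E =
   (\prod_(i <- s) fine (normal_prob 0 1 (A i)))%:E)%E.
Proof.
case: Yiid => Yind Ylaw us mA.
pose J := [fset i in s]%fset.
have sJ : perm_eq s (enum_fset J).
  by apply: uniq_perm => //; move=> i; rewrite in_fset.
have mYA i : measurable (Y i @^-1` A i).
  by rewrite -[X in measurable X]setTI; exact: measurable_funP.
transitivity (P (\bigcap_(i in [set` J]) (Y i @^-1` A i))).
  have mB : measurable (\bigcap_(i in [set` J]) (Y i @^-1` A i)).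
    by apply: fin_bigcap_measurable => //; exact: finite_fset.
  rewrite -[in RHS](setIT (\bigcap_(i in _) _)) -integral_indic//.
  apply: eq_integral => w _; congr EFin; rewrite (perm_big _ sJ)/=.
  rewrite indicE; case: (boolP (w \in _)) => [/set_mem h|/negP h].
    by rewrite big_seq big1// => i iJ; rewrite indicE mem_set//; exact: h.
  have [i iJ Ai] : exists2 i, i \in J & ~ A i (Y i w).
    apply: contrapT => h'; apply: h; apply/mem_set => i /= iJ.
    by apply: contrapT => nA; apply: h'; exists i.
  by apply/eqP; rewrite prodf_seq_eq0; apply/hasP; exists i => //=; rewrite indicE memNset.
rewrite Yind// -prodEFin (perm_big _ sJ)/=; apply: eq_bigr => i _.
rewrite fineK; first exact: (Ylaw i _ (mA i)).
by apply: fin_num_measure; exact: mA.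
Qed.

(** Indicators are replaced by functions one index at a time. Keeping a block of arbitrary
    indicators makes the induction hypothesis yield the law of the next variable under the weight
    [W], as [ge0_integral_weighted] requires. *)
Lemma indep_expectation (s1 s2 : seq I) (f : I -> R -> R) (A : I -> set R) (m : I -> R) :
  uniq (s1 ++ s2) ->
  (forall i, measurable_fun setT (f i)) -> (forall i x, 0 <= f i x) ->
  (forall i, measurable (A i)) ->
  (forall i, \int[normal_prob 0 1]_x (f i x)%:E = (m i)%:E)%E ->
  (\int[P]_w (\prod_(i <- s1) f i (Y i w) * \prod_(i <- s2) \1_(A i) (Y i w))%:E =
   (\prod_(i <- s1) m i * \prod_(i <- s2) fine (normal_prob 0 1 (A i)))%:E)%E.
Proof.
move=> us mf f0 + fm; elim: s1 s2 A us => [|j s1 IH] s2 A us mA.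
  rewrite big_nil mul1r -indep_indicators//.
  by apply: eq_integral => w _; rewrite big_nil mul1r.
move: us; rewrite cat_cons cons_uniq => /andP[]; rewrite mem_cat negb_or => /andP[js1 js2] us.
pose W w := \prod_(i <- s1) f i (Y i w) * \prod_(i <- s2) \1_(A i) (Y i w).
have m0 i : 0 <= m i.
  by rewrite -lee_fin -fm; apply: integral_ge0 => x _; rewrite lee_fin.
pose c := \prod_(i <- s1) m i * \prod_(i <- s2) fine (normal_prob 0 1 (A i)).
have c0 : 0 <= c.
  by rewrite mulr_ge0// prodr_ge0// => i _; exact: fine_ge0.
have W0 w : 0 <= W w by rewrite mulr_ge0// prodr_ge0.
have mW : measurable_fun setT W.
  apply: measurable_funM; apply: measurable_prod => i _.
    exact: measurableT_comp.
  by apply: measurableT_comp => //; exact: measurable_indic.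
have WX B : measurable B ->
    (\int[P]_w (W w * \1_B (Y j w))%:E = c%:E * normal_prob 0 1 B)%E.
  (* The next index [j] first enters the indicator block, with an arbitrary event [B]. *)
  move=> mB; pose A' i := if i == j then B else A i.
  have A'E i : i \in s2 -> A' i = A i.
    by rewrite /A'; case: eqP => // -> js; rewrite js in js2.
  have mA' i : measurable (A' i) by rewrite /A'; case: ifP.
  transitivity (\int[P]_w (\prod_(i <- s1) f i (Y i w) *
      \prod_(i <- j :: s2) \1_(A' i) (Y i w))%:E)%E.
    apply: eq_integral => w _; congr EFin; rewrite big_cons {1}/A' eqxx /W -mulrA.
    congr (_ * _); rewrite mulrC; congr (_ * _).
    by apply: eq_big_seq => i /A'E ->.
  rewrite IH//; last first.
    by rewrite uniq_catC cat_cons cons_uniq uniq_catC us andbT mem_cat negb_or js1 js2.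
  rewrite big_cons {1}/A' eqxx mulrCA mulrC EFinM fineK ?fin_num_measure//.
  by congr ((_ * _)%:E * _)%E; apply: eq_big_seq => i /A'E ->.
have := @ge0_integral_weighted _ _ _ P (normal_prob 0 1) W (Y j) c mW W0
  (measurable_funPT (Y j)) c0 WX (f j) (mf j) (f0 j).
rewrite fm -EFinM => h; transitivity (c * m j)%:E.
  by rewrite -h; apply: eq_integral => w _; congr EFin; rewrite big_cons /W; ring.
by congr EFin; rewrite big_cons /c; ring.
Qed.

Lemma gaussian_sum_mgf (s : seq I) (c : I -> R) : uniq s ->
  (\int[P]_w (expR (\sum_(i <- s) c i * Y i w))%:E =
   (expR ((\sum_(i <- s) c i ^+ 2) / 2))%:E)%E.
Proof.
move=> us; rewrite mulr_suml expR_sum.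
have := @indep_expectation s [::] (fun i x => expR (c i * x)) (fun=> setT)
  (fun i => expR (c i ^+ 2 / 2)).
rewrite cats0 big_nil mulr1 => <-//.
- by apply: eq_integral => w _; rewrite big_nil mulr1 expR_sum.
- by move=> i; apply: measurableT_comp => //; exact: measurable_funM.
- by move=> i; exact: normal_mgf.
Qed.

End GaussianExponentialMoments.

(** * Second moment bound for orthonormal Gaussian sums *)

Section ManyOrthogonalGaussians.
Context (R : realType) (d : measure_display) (Om : measurableType d).
Variables (P : probability Om R) (I : choiceType) (Y : I -> {RV P >-> R}).
Hypothesis Yiid : iid_standard_normal Y.
Variables (J : seq I) (n : nat) (c : 'I_n -> I -> R).
Hypothesis uniqJ : uniq J.
Hypothesis c_orthonormal : forall i j, \sum_(v <- J) c i v * c j v = (i == j)%:R.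

Let Z i w := \sum_(v <- J) c i v * Y v w.

Let measurable_Z i : measurable_fun setT (Z i).
Proof. by apply: measurable_sum => v; exact: measurable_funM. Qed.

Let expectation_expZ (l : R) i : (\int[P]_w (expR (l * Z i w))%:E = (expR (l ^+ 2 / 2))%:E)%E.
Proof.
transitivity (\int[P]_w (expR (\sum_(v <- J) (l * c i v) * Y v w))%:E)%E.
  apply: eq_integral => w _; congr (expR _)%:E; rewrite mulr_sumr.
  by apply: eq_bigr => v _; rewrite mulrA.
rewrite gaussian_sum_mgf//; congr (expR (_ / 2))%:E.
transitivity (l ^+ 2 * \sum_(v <- J) c i v * c i v).
  by rewrite mulr_sumr; apply: eq_bigr => v _; rewrite exprMn.
by rewrite c_orthonormal eqxx mulr1.
Qed.

Let expectation_expZZ (l : R) i j :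
  (\int[P]_w (expR (l * Z i w) * expR (l * Z j w))%:E =
   (expR (l ^+ 2 * (1 + (i == j)%:R)))%:E)%E.
Proof.
transitivity (\int[P]_w (expR (\sum_(v <- J) (l * (c i v + c j v)) * Y v w))%:E)%E.
  apply: eq_integral => w _; congr EFin; rewrite -expRD -mulrDr; congr expR.
  rewrite /Z -big_split/= mulr_sumr.
  by apply: eq_bigr => v _; rewrite -mulrDl mulrA.
rewrite gaussian_sum_mgf//; congr (expR _)%:E.
transitivity (l ^+ 2 / 2 * (\sum_(v <- J) c i v * c i v + \sum_(v <- J) c j v * c j v
    + (\sum_(v <- J) c i v * c j v + \sum_(v <- J) c i v * c j v))).
  rewrite -!big_split/= mulr_suml mulr_sumr; apply: eq_bigr => v _.
  by field.
by rewrite !c_orthonormal !eqxx/=; field.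
Qed.

(* Second moment method: on [E] the sum of the exp(l * Z i) stays far below
   its mean, and its variance is only linear in n. *)
Lemma orthogonal_gaussians_count (E : set Om) (K : R) : measurable E -> 0 <= K ->
  (forall w, E w -> forall i, Z i w <= K) ->
  fine (P E) * n%:R <= expR (2 * (2 * K + 2) ^+ 2).
Proof.
move=> mE K0 EK; have [->|n0] := eqVneq n 0%N.
  by rewrite mulr0 expR_ge0.
have {}n0 : 0 < n%:R :> R by rewrite ltr0n lt0n.
(* With this [l], [l ^+ 2 / 2 = l * K + l], so the mean [m] of each exponential exceeds its bound
   [expR (l * K)] on [E] by at least 1. *)
pose l := 2 * K + 2; pose m := expR (l ^+ 2 / 2); pose a := n%:R * m.
pose S w := \sum_i expR (l * Z i w).
have l0 : 0 <= l by rewrite /l; lra.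
have mexpZ i : measurable_fun setT (fun w => expR (l * Z i w)).
  by apply: measurableT_comp => //; exact: measurable_funM.
have mS : measurable_fun setT S by exact: measurable_sum.
have S0 w : 0 <= S w by apply: sumr_ge0 => i _; exact: expR_ge0.
have m0 : 0 <= m := expR_ge0 _.
have a0 : 0 <= a by rewrite mulr_ge0.
have intS : (\int[P]_w (S w)%:E = a%:E)%E.
  under eq_integral do rewrite /S -sumEFin.
  rewrite ge0_integral_sum//; last by move=> i; apply/measurable_EFinP.
  rewrite (eq_bigr _ (fun i _ => expectation_expZ l i)).
  by rewrite sumEFin sumr_const card_ord -[RHS]/((n%:R * m)%:E) mulr_natl.
have intS2 : (\int[P]_w (S w ^+ 2)%:E <=
    (n%:R * expR (2 * l ^+ 2) + a ^+ 2)%:E)%E.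
  apply: (@le_trans _ _
      (\sum_(i < n) \sum_(j < n) (expR (l ^+ 2 * (1 + (i == j)%:R)))%:E)%E).
    rewrite le_eqVlt; apply/orP; left; apply/eqP.
    transitivity (\int[P]_w (\sum_(i < n) \sum_(j < n)
        (expR (l * Z i w) * expR (l * Z j w))%:E))%E.
      apply: eq_integral => w _; rewrite expr2 /S mulr_suml -sumEFin.
      by apply: eq_bigr => i _; rewrite mulr_sumr sumEFin.
    rewrite ge0_integral_sum//; last 2 first.
    - move=> i; apply: emeasurable_sum => j; apply/measurable_EFinP.
      exact: measurable_funM.
    - by move=> i w _; apply: sume_ge0 => j _; rewrite lee_fin mulr_ge0 ?expR_ge0.
    apply: eq_bigr => i _; rewrite ge0_integral_sum//; last first.
      by move=> j; apply/measurable_EFinP; exact: measurable_funM.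
    by apply: eq_bigr => j _; exact: expectation_expZZ.
  rewrite (eq_bigr _ (fun i _ => sumEFin _ _ _)) sumEFin lee_fin.
  (* Diagonal terms equal [expR (2 * l ^+ 2)], the others [m ^+ 2]; a surplus [m ^+ 2] on the
     diagonal completes [a ^+ 2]. *)
  have -> : n%:R * expR (2 * l ^+ 2) + a ^+ 2 =
      \sum_(i < n) (expR (2 * l ^+ 2) + \sum_(j < n) m ^+ 2).
    rewrite !sumr_const card_ord -(mulr_natl (m ^+ 2)) -(mulr_natl (_ + _)) /a.
    by ring.
  apply: ler_sum => i _; rewrite (bigD1 i)//= eqxx [X in _ <= _ + X](bigD1 i)//=.
  rewrite (_ : l ^+ 2 * (1 + 1) = 2 * l ^+ 2); last by ring.
  rewrite lerD2l -[leLHS]add0r lerD ?sqr_ge0//.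
  apply: ler_sum => j ji; rewrite eq_sym (negbTE ji) addr0 mulr1 /m -expRM_natl.
  by rewrite ler_expR mulr_natl -mulr_natl; lra.
(* Chebyshev's inequality in pointwise form, [n%:R ^+ 2 * \1_E w <= (a - S w) ^+ 2], rearranged so
   that both integrands are nonnegative. *)
have key w : n%:R ^+ 2 * \1_E w + (2 * a) * S w <= S w ^+ 2 + a ^+ 2.
  have : n%:R ^+ 2 * \1_E w <= (a - S w) ^+ 2; last by rewrite sqrrB; lra.
  rewrite indicE; case: (boolP (w \in E)) => [/set_mem Ew|_]; last first.
    by rewrite mulr0 sqr_ge0.
  have nS : n%:R <= a - S w.
    have -> : n%:R = \sum_(i < n) (1 : R) by rewrite sumr_const card_ord.
    have -> : a = \sum_(i < n) m by rewrite sumr_const card_ord -mulr_natl.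
    rewrite -sumrB; apply: ler_sum => i _.
    have h1 : expR (l * Z i w) <= expR (l * K) by rewrite ler_expR ler_wpM2l// EK.
    have h2 : m = expR (l * K) * expR l.
      by rewrite -expRD /m; congr expR; rewrite /l; field.
    have h3 : 1 + l <= expR l := expR_ge1Dx l.
    have h4 : 1 <= expR (l * K) by rewrite -[leLHS]expR0 ler_expR mulr_ge0.
    by rewrite h2; rewrite /l in l0 h3 *; nra.
  by rewrite mulr1 ler_sqr ?nnegrE ?ler0n// (le_trans _ nS).
have : (\int[P]_w (n%:R ^+ 2 * \1_E w + (2 * a) * S w)%:E <=
        \int[P]_w (S w ^+ 2 + a ^+ 2)%:E)%E.
  apply: ge0_le_integral => //.
  - by move=> w _; rewrite lee_fin addr_ge0// mulr_ge0// mulr_ge0.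
  - apply/measurable_EFinP; apply: measurable_funD; apply: measurable_funM => //.
  - by apply/measurable_EFinP; apply: measurable_funD => //; exact: measurable_funX.
  - by move=> w _; rewrite lee_fin.
under eq_integral do rewrite EFinD.
rewrite ge0_integralD//; last 3 first.
- by apply/measurable_EFinP; exact: measurable_funM.
- by move=> w _; rewrite lee_fin mulr_ge0// mulr_ge0.
- by apply/measurable_EFinP; exact: measurable_funM.
under eq_integral do rewrite EFinM.
rewrite ge0_integralZl//; last by apply/measurable_EFinP.
rewrite integral_indic// setIT.
under [X in (_ + X <= _)%E]eq_integral do rewrite EFinM.
rewrite ge0_integralZl//; last 3 first.
- by apply/measurable_EFinP.
- by move=> w _; rewrite lee_fin.
- by rewrite lee_fin mulr_ge0.
rewrite intS.
under [X in (_ <= X)%E]eq_integral do rewrite EFinD.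
rewrite ge0_integralD//; last 3 first.
- by move=> w _; rewrite lee_fin sqr_ge0.
- by apply/measurable_EFinP; exact: measurable_funX.
- by move=> w _; rewrite lee_fin sqr_ge0.
have -> : (\int[P]_w (a ^+ 2)%:E = (a ^+ 2)%:E)%E.
  rewrite integral_cst// -[RHS]mule1; congr (_ * _)%E.
  exact: probability_setT.
move=> h.
have {h} := le_trans h (leeD2r _ intS2).
rewrite [X in (_ * X + _ <= _)%E](_ : _ = (fine (P E))%:E); last first.
  by rewrite fineK// fin_num_measure.
rewrite -!EFinM -!EFinD lee_fin => h.
by rewrite -(ler_pM2l n0); lra.
Qed.

End ManyOrthogonalGaussians.

(** * Almost sure boundedness over a countable index set *)

Section BoundedProcesses.
Context (R : realType) (d : measure_display) (Om : measurableType d).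
Variable P : probability Om R.

Lemma countable_enum (T : choiceType) : countable [set: T] -> T ->
  exists g : nat -> T, forall t, exists n, g n = t.
Proof.
move=> /countable_injP[f finj] t0.
exists (fun n => xget t0 [set t | f t = n]) => t; exists (f t).
by apply: finj; rewrite ?inE//; exact: (@xgetPex _ t0 [set u | f u = f t]) (ex_intro _ t erefl).
Qed.

Lemma measurable_le_level (T : choiceType) (X : T -> Om -> R) (M : R) :
  countable [set: T] -> (forall t, measurable_fun setT (X t)) ->
  measurable [set w | forall t, `|X t w| <= M].
Proof.
move=> cT mX; have [[t0]|noT] := pselect (inhabited T); last first.
  rewrite (_ : [set w | _] = setT)//; apply/seteqP; split => // w _ t.
  by exfalso; exact: (noT (inhabits t)).
have [g gsurj] := countable_enum cT t0.
rewrite (_ : [set w | _] = \bigcap_n [set w | `|X (g n) w| <= M]); last first.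
  apply/seteqP; split=> [w h n _|w h t] /=; first exact: h.
  by have [n <-] := gsurj t; exact: h.
apply: bigcapT_measurable => n.
have mb : measurable_fun setT (fun w => `|X (g n) w| <= M).
  by apply: measurable_fun_ler => //; exact: measurableT_comp.
by have := mb measurableT [set true]; rewrite setTI; apply.
Qed.

Lemma ereal_sup_levels (T : choiceType) (X : T -> Om -> R) :
  [set w | (ereal_sup [set (`|X t w|)%:E | t in [set: T]] < +oo)%E] =
  \bigcup_k [set w | forall t, `|X t w| <= k%:R].
Proof.
apply/seteqP; split=> [w /= h|w [k _ /= h]].
  have [k hk] : exists k : nat, (ereal_sup [set (`|X t w|)%:E | t in [set: T]] <= k%:R%:E)%E.
    case E : (ereal_sup _) h => [r| |]// _; last by exists 0%N; rewrite leNye.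
    by exists (Num.truncn r).+1; rewrite lee_fin ltW// truncnS_gt.
  exists k => // t; rewrite -lee_fin; apply: le_trans hk.
  by apply: ereal_sup_ubound; exists t.
apply: (@le_lt_trans _ _ k%:R%:E); last exact: ltry.
by apply: ge_ereal_sup => _ [t _ <-]; rewrite lee_fin.
Qed.

(** The levels cover an event of probability one, and a countable union of null events is null. *)
Lemma as_bounded_level (T : choiceType) (X : T -> Om -> R) :
  countable [set: T] -> (forall t, measurable_fun setT (X t)) -> as_bounded P X ->
  exists k : nat, (0 < P [set w | forall t, (`|X t w| <= k%:R)%R])%E.
Proof.
move=> cT mX; rewrite /as_bounded ereal_sup_levels => P1; apply: contrapT => h.
have P0 k : P [set w | forall t, `|X t w| <= k%:R] = 0%E.
  apply/eqP; rewrite eq_le measure_ge0 andbT leNgt; apply/negP => p.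
  by apply: h; exists k.
have : P (\bigcup_k [set w | forall t, `|X t w| <= k%:R]) = 0%E.
  apply/negligibleP.
    by apply: bigcupT_measurable => k; exact: measurable_le_level.
  apply: negligible_bigcup => k; apply/negligibleP; last exact: P0.
  exact: measurable_le_level.
by move=> /(etrans (esym P1))/eqP; rewrite onee_eq0.
Qed.

End BoundedProcesses.

(** * The tree process and its increments over disjoint segments *)

Section TreeProcess.
Variables (R : realType) (T : rootedTree) (alpha sigma : T -> R).
Hypothesis sigma_ge0 : forall t, 0 <= sigma t.
Hypothesis sigma_noninc : sigma_nonincreasing sigma.
Context (d : measure_display) (Om : measurableType d) (P : probability Om R).
Variable xi : T -> {RV P >-> R}.
Hypothesis xi_iid : iid_standard_normal xi.
Implicit Types (t s r e : T).

Local Notation len t s := (Num.sqrt (\sum_(v \in branch_seg t s) alpha v ^+ 2)).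
Local Notation bd := (branch_dist alpha sigma).
Local Notation X := (tree_process alpha sigma xi).
Local Notation dst := (tree_dist alpha sigma).

Lemma measurable_tree_process t : measurable_fun setT (X t).
Proof.
apply: measurable_funM => //.
under eq_fun do rewrite (fsbig_finite _ _ (finite_tree_le t)).
by apply: measurable_sum => v; exact: measurable_funM.
Qed.

Lemma tree_process_split t s w : tree_le t s ->
  X s w = sigma s * (\sum_(v \in [set v | tree_le v t]) alpha v * xi v w) +
          sigma s * (\sum_(v \in branch_seg t s) alpha v * xi v w).
Proof. by move=> ts; rewrite /tree_process (ancestor_sum_split _ ts) mulrDr. Qed.

Lemma tree_process_ancestor_le t s w : tree_le t s ->
  `|sigma s * (\sum_(v \in [set v | tree_le v t]) alpha v * xi v w)| <= `|X t w|.
Proof.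
move=> ts; rewrite /tree_process !normrM ler_wpM2r//.
by rewrite !ger0_norm// sigma_noninc.
Qed.

Lemma tree_process_increment_le t s w : tree_le t s ->
  `|sigma s * (\sum_(v \in branch_seg t s) alpha v * xi v w)| <= `|X s w| + `|X t w|.
Proof.
move=> ts; have := tree_process_ancestor_le w ts; rewrite (tree_process_split w ts).
set a := sigma s * _; set b := sigma s * _ => aX.
have := ler_normB (a + b) a; rewrite [X in `|X| <= _](_ : _ = b); last by ring.
by move=> /le_trans; apply; rewrite lerD2l.
Qed.

(** Each separated point contributes the Gaussian sum over a minimal long segment of its branch,
    divided by the length. Disjointness makes these sums orthonormal, and on the event they are at
    most [2 * M / eps]; [orthogonal_gaussians_count] limits their number. *)
Lemma separated_count (M eps : R) (n : nat) : 0 <= M -> 0 < eps ->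
  ~ covers dst n (2 * eps) ->
  fine (P [set w | forall t, `|X t w| <= M]) * n%:R <=
  expR (2 * (2 * (2 * M / eps) + 2) ^+ 2).
Proof.
move=> M0 eps0 ncov.
have [s [_ s0 sep]] := exists_separated (tree_root T) ncov (leqnn n).
(* Of the [n.+1] separated points the first is the root; the shift keeps the other [n], all at
   distance at least [2 * eps] from the root. *)
pose a (i : 'I_n) := nth (tree_root T) s i.+1.
have /choice[e] : forall i, exists e, exists r, [/\ branch_seg e (a i) r,
    eps <= sigma r * len e r & forall v, branch_seg e (a i) v -> bd v (a i) < eps].
  move=> i; apply: shortest_long_branch => //.
  have := sep 0%N i.+1; rewrite s0 /= => /(_ (ltn_ord i)).
  rewrite tree_distE (tree_meet_idl (root_le _)) branch_dist_refl add0r.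
  by apply: le_trans; lra.
move=> /choice[r er].
(* The segment is cut at [r i], where [sigma] times the length reaches [eps]; a subsegment remains
   disjoint from the others. *)
pose D i := branch_seg (e i) (r i).
have Dsub i : D i `<=` branch_seg (e i) (a i).
  by have [[_ ra] _ _] := er i; apply: branch_segS => //; exact: tree_le_refl.
have Ddisj i j : i != j -> D i `&` D j = set0.
  wlog ij : i j / (i < j)%N => [hw ne|ne].
    have [ij|ji|/val_inj ij] := ltngtP i j; first exact: hw.
      by rewrite setIC; apply: hw => //; rewrite eq_sym.
    by rewrite ij eqxx in ne.
  have [_ _ hi] := er i; have [_ _ hj] := er j.
  have disj := separated_branches_disjoint sigma_ge0 sigma_noninc hi hj.
  apply/seteqP; split => // v [vi vj]; rewrite -disj; first by split; exact: Dsub.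
  by apply: sep; rewrite ltnS ij /= .
pose J : seq T := fset_set (\bigcup_(i in [set: 'I_n]) D i).
have DJ i : D i `<=` [set` J].
  move=> v vD; rewrite /= in_fset_set ?mem_set//; first by exists i.
  by apply: bigcup_finite => // j _; exact: finite_branch_seg.
pose l i := len (e i) (r i).
have lr0 i : 0 < sigma (r i) * l i by have [_ h _] := er i; exact: lt_le_trans h.
have r0 i : 0 < sigma (r i).
  by rewrite lt0r sigma_ge0 andbT; apply/eqP => h; have := lr0 i; rewrite h mul0r ltxx.
have l0 i : 0 < l i by have := lr0 i; rewrite pmulr_rgt0.
pose c i v := if v \in D i then alpha v / l i else 0.
apply: (@orthogonal_gaussians_count _ _ _ P _ xi xi_iid J n c) => //.
- exact: fset_uniq.
- move=> i j; have [<-|ij] := eqVneq i j.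
    transitivity (\sum_(v <- J) (if v \in D i then alpha v ^+ 2 / l i ^+ 2 else 0)).
      apply: eq_bigr => v _; rewrite /c; case: ifP; rewrite ?mul0r// => _.
      by rewrite -expr_div_n expr2.
    rewrite sum_seq_restrict//; last exact: fset_uniq.
    rewrite (eq_fsbigr (fun v => alpha v ^+ 2 * (l i ^+ 2)^-1))//.
    rewrite -mulr_fsuml -[X in X / _](@sqr_sqrtr _ (\sum_(v \in D i) alpha v ^+ 2)).
      by apply: divff; rewrite expf_neq0// -/(l i) gt_eqF.
    by apply: fsumr_ge0 => v _; exact: sqr_ge0.
  rewrite big1// => v _; rewrite /c; case: ifP; rewrite ?mul0r// => /set_mem vi.
  case: ifP; rewrite ?mulr0// => /set_mem vj.
  by have : (D i `&` D j) v by []; rewrite Ddisj.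
- exact: measurable_le_level (countable_tree T) measurable_tree_process.
- by rewrite !mulr_ge0// invr_ge0 ltW.
move=> w /= wM i.
have -> : \sum_(v <- J) c i v * xi v w = (\sum_(v \in D i) alpha v * xi v w) / l i.
  transitivity (\sum_(v <- J) (if v \in D i then alpha v * xi v w / l i else 0)).
    apply: eq_bigr => v _; rewrite /c; case: ifP; rewrite ?mul0r// => _.
    by rewrite mulrAC.
  by rewrite sum_seq_restrict// ?mulr_fsuml//; exact: fset_uniq.
have [[[ei _] _] le _] := er i.
have := tree_process_increment_le w ei.
rewrite -/(D i); set A := \sum_(v \in _) _ => Ale.
rewrite ler_pdivrMr// -(ler_pM2l (r0 i)).
apply: (@le_trans _ _ (2 * M)).
  apply: le_trans (ler_norm _) _; apply: le_trans Ale _.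
  by have := wM (r i); have := wM (e i); lra.
have -> : sigma (r i) * (2 * M / eps * l i) = 2 * M * (sigma (r i) * l i / eps) by ring.
by rewrite ler_peMr ?mulr_ge0// ler_pdivlMr// mul1r.
Qed.

End TreeProcess.

(** * Necessity: entropy bounds from boundedness *)

Section NecessaryCondition.
Variables (R : realType) (T : rootedTree) (alpha sigma : T -> R).
Hypothesis sigma_ge0 : forall t, 0 <= sigma t.
Hypothesis sigma_noninc : sigma_nonincreasing sigma.
Context (d : measure_display) (Om : measurableType d) (P : probability Om R).
Variable xi : T -> {RV P >-> R}.
Hypothesis xi_iid : iid_standard_normal xi.
Hypothesis X_bounded : as_bounded P (tree_process alpha sigma xi).

Local Notation bd := (branch_dist alpha sigma).
Local Notation X := (tree_process alpha sigma xi).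
Local Notation dst := (tree_dist alpha sigma).

(** On a level event of probability [p > 0], [separated_count] bounds every [n] for which [n] balls
    cannot cover, so the first integer past that bound admits a cover. *)
Lemma gaussian_entropy_bound : exists M p : R, [/\ 0 <= M, 0 < p &
  forall eps, 0 < eps -> exists2 n, covers dst n (2 * eps) &
    (0 < n)%N /\ ln n%:R <= ln (2 / p) + 2 * (2 * (2 * M / eps) + 2) ^+ 2].
Proof.
have [k] := as_bounded_level (countable_tree T) (measurable_tree_process alpha sigma xi) X_bounded.
set E := [set w | _] => PE.
have mE : measurable E.
  exact: measurable_le_level (countable_tree T) (measurable_tree_process alpha sigma xi).
have PEE : P E = (fine (P E))%:E by rewrite fineK// fin_num_measure.
set p := fine (P E) in PEE.
have p0 : 0 < p by rewrite -lte_fin -PEE.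
have p1 : p <= 1 by rewrite -lee_fin -PEE probability_le1.
exists k%:R, p; split => // eps eps0.
set e := 2 * (_ + 2) ^+ 2; pose b := expR e / p.
have e0 : 0 <= e by rewrite mulr_ge0// sqr_ge0.
have b1 : 1 <= b by rewrite ler_pdivlMr// mul1r (le_trans p1)// -expR0 ler_expR.
have b0 : 0 <= b := le_trans ler01 b1.
exists (Num.truncn b).+1.
  apply: contrapT => ncov.
  have := separated_count sigma_ge0 sigma_noninc xi_iid (ler0n R k) eps0 ncov.
  rewrite -/E -/p -/e mulrC -ler_pdivlMr// -/b leNgt.
  by rewrite truncnS_gt.
split => //; rewrite -[e]expRK -lnM ?posrE ?divr_gt0 ?expR_gt0//.
rewrite ler_ln ?posrE ?ltr0n// ?mulr_gt0 ?expR_gt0 ?invr_gt0//.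
have -> : 2 / p * expR e = 2 * b by rewrite /b; field; rewrite gt_eqF.
(* The chosen integer is at most [b + 1 <= 2 * b], whence the 2 in [2 / p]. *)
have := truncn_le b; rewrite b0 -natr1 => h.
by have := h; lra.
Qed.

(** A finite net at one scale bounds all distances from the root. Beyond [B], a single ball around
    the root covers the tree and the entropy vanishes. *)
Lemma bounded_root_dist : exists2 B, 0 < B & forall t, bd (tree_root T) t < B.
Proof.
have [M [p [_ _ /(_ _ ltr01)[n [c cP] _]]]] := gaussian_entropy_bound.
have [c' c'P] := order_net sigma_ge0 sigma_noninc cP.
exists (\sum_i bd (tree_root T) (c' i) + 4).
  by rewrite ltr_wpDl// sumr_ge0// => i _; exact: branch_dist_ge0.
move=> t; have [i it] := c'P t; rewrite mulr1 => ht.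
have := branch_dist_triangle alpha sigma_ge0 sigma_noninc (root_le (c' i)) it.
have : bd (tree_root T) (c' i) <= \sum_i bd (tree_root T) (c' i).
  rewrite [leRHS](bigD1 i)//= lerDl sumr_ge0// => j _; exact: branch_dist_ge0.
by lra.
Qed.

Lemma bounded_tree_entropy :
  (ereal_sup [set eps%:E * sqrte (lne (covering_number dst eps))
             | eps in [set eps : R | (0 < eps)%R]] < +oo)%E.
Proof.
have [B B0 rootB] := bounded_root_dist.
have [M [p [M0 p0 entropy]]] := gaussian_entropy_bound.
(* The entropy bound at [eps / 2], multiplied by [eps ^+ 2], with the remaining [eps] replaced by
   its upper bound [B]. *)
pose L := B ^+ 2 * `|ln (2 / p)| + 2 * (8 * M + 2 * B) ^+ 2.
apply: (@le_lt_trans _ _ (Num.sqrt L)%:E); last exact: ltry.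
apply: ge_ereal_sup => _ [eps /= eps0 <-].
have [Beps|epsB] := leP B eps.
  rewrite (_ : covering_number _ _ = 1%E); first by rewrite lne1 sqrte0 mule0 lee_fin sqrtr_ge0.
  apply/eqP; rewrite eq_le covering_number_ge1 andbT.
  apply: (@covering_number_le _ _ _ 1%N) => //; exists (fun=> tree_root T) => s.
  exists ord0; rewrite tree_distE (tree_meet_idl (root_le _)) branch_dist_refl add0r.
  exact: lt_le_trans Beps.
have [|n ncov [n0 lnn]] := entropy (eps / 2); first by rewrite divr_gt0.
rewrite mulrC divfK// in ncov.
have le1 : (1 <= n%:R%:E :> \bar R)%E by rewrite lee_fin ler1n.
apply: (@le_trans _ _ (eps%:E * sqrte (lne n%:R%:E))%E).
  apply: lee_wpmul2l; first by rewrite lee_fin ltW.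
  rewrite lee_sqrt; last by rewrite lne_ge0.
  rewrite lee_lne ?covering_number_le// in_itv/= leey andbT (le_trans lee01)//.
  exact: covering_number_ge1.
rewrite lne_EFin ?ltr0n//= -EFinM lee_fin.
have ln0 : 0 <= ln n%:R :> R by rewrite ln_ge0// ler1n.
rewrite -[leLHS]ger0_norm ?mulr_ge0 ?sqrtr_ge0 ?(ltW eps0)// -sqrtr_sqr ler_wsqrtr//.
rewrite exprMn sqr_sqrtr//.
apply: (@le_trans _ _ (eps ^+ 2 * (`|ln (2 / p)| + 2 * (2 * (2 * M / (eps / 2)) + 2) ^+ 2))).
  rewrite ler_wpM2l ?sqr_ge0//; apply: le_trans lnn _.
  by rewrite lerD2r ler_norm.
rewrite mulrDr; have -> : eps ^+ 2 * (2 * (2 * (2 * M / (eps / 2)) + 2) ^+ 2) =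
    2 * (8 * M + 2 * eps) ^+ 2.
  by field; rewrite gt_eqF.
rewrite /L lerD//.
  by rewrite ler_wpM2r// ler_sqr ?nnegrE; lra.
by rewrite ler_pM2l// ler_sqr ?nnegrE; lra.
Qed.

End NecessaryCondition.

(** * From the entropy integral to dyadic nets *)

Section EntropyIntegral.
Variable R : realType.

(** Preimages of upper rays are intervals, and such rays generate the measurable sets. *)
Lemma ereal_nonincreasing_measurable (f : R -> \bar R) :
  (forall x y, x <= y -> (f y <= f x)%E) -> measurable_fun setT f.
Proof.
move=> fni.
apply: (measurability _ (ErealGenOInfty.measurableE R)) => _ [_ [r ->] <-].
rewrite setTI; apply: is_interval_measurable => s t /=.
rewrite !in_itv/= !andbT => fs ft u /andP[su ut].
by rewrite in_itv/= andbT (lt_le_trans ft)// fni.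
Qed.

Lemma sum_geometric_half (K : nat) : \sum_(k < K) (2^-1 : R) ^+ k.+1 <= 1.
Proof.
suff -> : \sum_(k < K) (2^-1 : R) ^+ k.+1 = 1 - 2^-1 ^+ K.
  by rewrite lerBlDr lerDl exprn_ge0// invr_ge0.
elim: K => [|K IH]; first by rewrite big_ord0 expr0 subrr.
by rewrite big_ord_recr/= IH exprS; lra.
Qed.

Lemma sum_arith_geometric_half (K : nat) : \sum_(k < K) k.+1%:R * (2^-1 : R) ^+ k <= 4.
Proof.
suff -> : \sum_(k < K) k.+1%:R * (2^-1 : R) ^+ k = 4 - (2 * K%:R + 4) * 2^-1 ^+ K.
  by rewrite lerBlDr lerDl mulr_ge0 ?exprn_ge0 ?invr_ge0// addr_ge0 ?mulr_ge0.
elim: K => [|K IH]; first by rewrite big_ord0 expr0; lra.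
by rewrite big_ord_recr/= IH exprS -!natr1; field.
Qed.

Local Notation mu := (@lebesgue_measure R).

(** On the interval from [2^-1 ^+ k.+1] to [2^-1 ^+ k], of length [2^-1 ^+ k.+1], [f] is at least
    its value at the right end. *)
Lemma dyadic_sum_le_integral (f : R -> \bar R) (K : nat) :
  (forall x, 0 <= f x)%E -> (forall x y, x <= y -> (f y <= f x)%E) ->
  (\sum_(k < K) (2^-1 ^+ k.+1)%:E * f (2^-1 ^+ k)%R <= \int[mu]_(x in `]0%R, +oo[) f x)%E.
Proof.
move=> f0 fni; have mf := ereal_nonincreasing_measurable fni.
apply: (@le_trans _ _ (\int[mu]_(x in `](2^-1 ^+ K)%R, 1%R]) f x)%E); last first.
  apply: ge0_subset_integral => //.
  - exact: measurable_funTS.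
  - move=> x /=; rewrite !in_itv/= andbT => /andP[h _].
    by apply: lt_trans h; rewrite exprn_gt0 // invr_gt0.
elim: K => [|K IH]; first by rewrite big_ord0; exact: integral_ge0.
have lt1 : (2^-1 : R) ^+ K.+1 < 2^-1 ^+ K.
  have : 0 < (2^-1 : R) ^+ K by rewrite exprn_gt0// invr_gt0.
  by rewrite exprS; lra.
have le1 : (2^-1 : R) ^+ K <= 1 by apply: exprn_ile1; lra.
have -> : `](2^-1 ^+ K.+1)%R, 1%R]%classic =
    `](2^-1 ^+ K.+1)%R, (2^-1 ^+ K)%R] `|` `](2^-1 ^+ K)%R, (1 : R)].
  apply/seteqP; split => x /=; rewrite !in_itv/=.
    move=> /andP[a b]; have [c|c] := leP x (2^-1 ^+ K); [left|right]; rewrite ?a ?b ?c//.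
  by move=> [/andP[a b]|/andP[a b]]; rewrite ?a ?b ?andbT/=;
    [exact: le_trans le1|exact: lt_trans a].
rewrite ge0_integral_setU//; last 2 first.
- exact: measurable_funTS.
- apply/disj_set2P; apply/seteqP; split => // x [/=]; rewrite !in_itv/=.
  by move=> /andP[_ a] /andP[b _]; move: (lt_le_trans b a); rewrite ltxx.
rewrite big_ord_recr/= addeC; apply: leeD => //.
apply: (@le_trans _ _ (\int[mu]_(x in `](2^-1 ^+ K.+1)%R, (2^-1 ^+ K)%R]) cst (f (2^-1 ^+ K)%R) x)%E).
  rewrite integral_cst// [X in (_ <= _ * X)%E](_ : _ = (2^-1 ^+ K.+1)%:E) 1?muleC//.
  etransitivity; first exact: lebesgue_measure_itv.
  by rewrite /= lte_fin lt1 -EFinB; congr EFin; rewrite exprS; lra.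
apply: ge0_le_integral => //.
- by move=> x _; exact: f0.
- exact: measurable_funTS.
- by move=> x /=; rewrite in_itv/= => /andP[_ h]; exact: fni.
Qed.

Lemma entropy_integral_nets (T : Type) (dist : T -> T -> R) :
  (\int[mu]_(eps in `]0%R, +oo[) sqrte (lne (covering_number dist eps)) < +oo)%E ->
  exists n : nat -> nat, exists C : R, [/\
    forall k, (0 < n k)%N /\ covers dist (n k) (2^-1 ^+ k),
    forall j k, (j <= k)%N -> (n j <= n k)%N &
    forall K, \sum_(k < K) 2^-1 ^+ k.+1 * Num.sqrt (ln (n k)%:R) <= C].
Proof.
pose f (eps : R) := sqrte (lne (covering_number dist eps)).
pose I := (\int[mu]_(x in `]0%R, +oo[) f x)%E; rewrite -/I => Ifin.
have f0 x : (0 <= f x)%E by exact: sqrte_ge0.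
have N0 x : (0 <= covering_number dist x)%E.
  by apply: le_trans (covering_number_ge1 _ _).
have fni x y : x <= y -> (f y <= f x)%E.
  move=> xy; rewrite /f lee_sqrt; last by rewrite lne_ge0 covering_number_ge1.
  by rewrite lee_lne ?covering_number_anti// in_itv/= leey N0.
have sumI K := dyadic_sum_le_integral K f0 fni.
have h0 k : 0 < (2^-1 : R) ^+ k by rewrite exprn_gt0// invr_gt0.
(* An infinite entropy at one scale would make a dyadic sum, hence the integral, infinite. *)
have ffin k : (f (2^-1 ^+ k)%R < +oo)%E.
  rewrite ltey; apply/eqP => fy; move: (sumI k.+1); rewrite big_ord_recr/= fy.
  rewrite gt0_muley ?lte_fin// addey; last first.
    by rewrite gt_eqF// (@lt_le_trans _ _ 0%E)// sume_ge0// => i _; rewrite mule_ge0// lee_fin ltW.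
  by rewrite leye_eq => /eqP e; rewrite /I e in Ifin.
have /choice[n nP] : forall k, exists n, [/\ (0 < n)%N, covers dist n (2^-1 ^+ k) &
    covering_number dist (2^-1 ^+ k) = n%:R%:E].
  move=> k; apply: covering_numberP; move: (ffin k); rewrite /f.
  by case: (covering_number _ _) (N0 (2^-1 ^+ k)) => [r| |]//= _; rewrite ltry.
have fE k : f (2^-1 ^+ k) = (Num.sqrt (ln (n k)%:R))%:E.
  by have [nk0 _ e] := nP k; rewrite /f e lne_EFin ?ltr0n.
exists n, (fine I); split.
- by move=> k; have [] := nP k.
- move=> j k jk; have [_ _ ej] := nP j; have [_ _ ek] := nP k.
  rewrite -(ler_nat R) -lee_fin -ej -ek; apply: covering_number_anti.
  by apply: ler_wiXn2l => //; lra.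
- move=> K; rewrite -lee_fin fineK; last first.
    by rewrite ge0_fin_numE// integral_ge0.
  apply: le_trans (sumI K); rewrite -sumEFin; apply: lee_sum => k _.
  by rewrite fE EFinM.
Qed.

End EntropyIntegral.

(** * Uniform bound for countably many finite subgaussian families *)

Section SubgaussianFamily.
Context (R : realType) (d : measure_display) (Om : measurableType d).
Variables (P : probability Om R) (Q : eqType) (U : nat -> seq Q).
Variables (s : nat -> R) (Z : nat -> Q -> Om -> R).
Hypothesis U_nonempty : forall k, (0 < size (U k))%N.
Hypothesis s_gt0 : forall k, 0 < s k.
Hypothesis measurable_Z : forall k q, measurable_fun setT (Z k q).
Hypothesis Z_subgaussian : forall k q, q \in U k -> forall l,
  (\int[P]_w (expR (l * Z k q w))%:E <= (expR (l ^+ 2 * s k ^+ 2 / 2))%:E)%E.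

(** The summand [k.+1] makes [size (U k) * expR (- L k)] summable in [k]; [l k] satisfies
    [l k ^+ 2 * s k ^+ 2 = L k]. *)
Let L k := ln (size (U k))%:R + k.+1%:R : R.
Let l k := Num.sqrt (L k) / s k.

(* The weights make the exponential moments of the whole family summable, so
   that [V] is integrable and hence almost surely finite. *)
Let V_ k w := \sum_(q <- U k)
  expR (- (3 / 2 * L k)) * (expR (l k * Z k q w) + expR (- l k * Z k q w)).
Let V w := (\sum_(k <oo) (V_ k w)%:E)%E.

Let L_ge1 k : 1 <= L k.
Proof. by rewrite /L -[leLHS]add0r lerD ?ln_ge0 ?ler1n. Qed.

Let measurable_V_ k : measurable_fun setT (V_ k).
Proof.
apply: measurable_sum => q; apply: measurable_funM => //.
by apply: measurable_funD; apply: measurableT_comp => //; exact: measurable_funM.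
Qed.

Let V_ge0 k w : 0 <= V_ k w.
Proof. by apply: sumr_ge0 => q _; rewrite mulr_ge0 ?addr_ge0 ?expR_ge0. Qed.

(** Each exponential moment is at most [expR (L k / 2)], so each [q] contributes at most
    [2 * expR (- L k)]; summing over [U k] leaves [2 * expR (- k.+1%:R)], and [expR 1 >= 2]. *)
Let int_V_ k : (\int[P]_w (V_ k w)%:E <= (2 * 2^-1 ^+ k.+1)%:E)%E.
Proof.
have mexp q a : measurable_fun setT (fun w => expR (a * Z k q w)).
  by apply: measurableT_comp => //; exact: measurable_funM.
under eq_integral do rewrite /V_ -sumEFin.
rewrite ge0_integral_sum//; last first.
  by move=> q; apply/measurable_EFinP; apply: measurable_funM => //; exact: measurable_funD.
have l2 a : a ^+ 2 = l k ^+ 2 -> a ^+ 2 * s k ^+ 2 / 2 = L k / 2.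
  move=> ->; rewrite /l expr_div_n divfK ?expf_neq0 ?gt_eqF//.
  by rewrite sqr_sqrtr// (le_trans ler01).
have bnd q : q \in U k ->
    (\int[P]_w (expR (- (3 / 2 * L k)) * (expR (l k * Z k q w) + expR (- l k * Z k q w)))%:E
     <= (2 * expR (- L k))%:E)%E.
  move=> qU; under eq_integral do rewrite EFinM EFinD.
  rewrite ge0_integralZl//; last 2 first.
  - by apply: emeasurable_funD; apply/measurable_EFinP.
  - by move=> w _; rewrite -EFinD lee_fin addr_ge0 ?expR_ge0.
  rewrite ge0_integralD//; [|by apply/measurable_EFinP..].
  apply: (@le_trans _ _ ((expR (- (3 / 2 * L k)))%:E * ((expR (L k / 2))%:E + (expR (L k / 2))%:E))%E).
    apply: lee_wpmul2l; first by rewrite lee_fin expR_ge0.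
    apply: leeD.
      by rewrite -(l2 (l k) erefl); exact: Z_subgaussian.
    by rewrite -(l2 (- l k) (sqrrN _)); exact: Z_subgaussian.
  rewrite -EFinD -EFinM lee_fin (_ : - L k = - (3 / 2 * L k) + L k / 2); last by field.
  by rewrite expRD; lra.
apply: (@le_trans _ _ (\sum_(q <- U k) (2 * expR (- L k))%:E)%E).
  by rewrite big_seq [leRHS]big_seq; apply: lee_sum => q; exact: bnd.
rewrite sumEFin lee_fin big_const_seq count_predT iter_addr_0 -[leLHS]mulr_natl mulrCA ler_pM2l//.
have Nk : 0 < (size (U k))%:R :> R by rewrite ltr0n.
rewrite /L opprD expRD !expRN lnK ?posrE// mulVKf ?gt_eqF//.
rewrite -[k.+1%:R]mul1r expRM_natr -exprVn lerXn2r ?nnegrE ?invr_ge0 ?expR_ge0//.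
by rewrite lef_pV2 ?posrE ?expR_gt0//; have := @expR_ge1Dx R 1; lra.
Qed.

(** Where [V] is finite it dominates each of its exponential terms, and taking logarithms bounds
    every [Z k q] at once. *)
Lemma subgaussian_family_bound :
  {ae P, forall w, exists2 A, 0 <= A & forall k q, q \in U k ->
    `|Z k q w| <= s k * (A + 2 * Num.sqrt (ln (size (U k))%:R + k.+1%:R))}.
Proof.
have mV : measurable_fun setT V.
  apply: ge0_emeasurable_sum => //.
    by move=> k w _ _; rewrite lee_fin.
  by move=> k _; apply/measurable_EFinP.
have intV : (\int[P]_w V w <= 2%:E)%E.
  rewrite /V integral_nneseries//; last 2 first.
  - by move=> k; apply/measurable_EFinP.
  - by move=> k w _; rewrite lee_fin.
  apply: lime_le.
    by apply: is_cvg_nneseries => k _ _; apply: integral_ge0 => w _; rewrite lee_fin.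
  apply: nearW => K; apply: (@le_trans _ _ (\sum_(0 <= k < K) (2 * 2^-1 ^+ k.+1)%:E)%E).
    by apply: lee_sum => k _; exact: int_V_.
  rewrite sumEFin lee_fin big_mkord -mulr_sumr -[leRHS]mulr1.
  by rewrite ler_pM2l// sum_geometric_half.
have iV : P.-integrable setT V.
  apply/integrableP; split => //.
  rewrite (eq_integral V); first exact: le_lt_trans intV (ltry _).
  move=> w _; rewrite gee0_abs//; apply: nneseries_ge0 => k _ _.
  by rewrite lee_fin.
have := integrable_ae measurableT iV.
apply: filterS => w /(_ I) Vfin; pose A := ln (1 + fine (V w)).
have V0 : 0 <= fine (V w).
  by apply: fine_ge0; apply: nneseries_ge0 => k _ _; rewrite lee_fin.
have A0 : 0 <= A by rewrite ln_ge0// lerDl.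
exists A => // k q qU.
have Lk := L_ge1 k; have s0 := s_gt0 k.
(* This lets the constant [A] be absorbed into [Num.sqrt (L k) * A] at the end. *)
have sL0 : 1 <= Num.sqrt (L k) by rewrite -[leLHS]sqrtr1 ler_wsqrtr.
have l0 : 0 < l k by rewrite divr_gt0// (lt_le_trans ltr01).
have VkV : V_ k w <= fine (V w).
  rewrite -lee_fin fineK//; apply: le_trans (@nneseries_lim_ge _ _ _ 0%N k.+1 _).
    rewrite big_nat_recr//= leeDr// sume_ge0// => j _; by rewrite lee_fin.
  by move=> j _ _; rewrite lee_fin.
have expV : expR (l k * `|Z k q w| - 3 / 2 * L k) <= fine (V w).
  apply: le_trans VkV; rewrite /V_ (perm_big _ (perm_to_rem qU))/= big_cons.
  apply: (@le_trans _ _ (expR (- (3 / 2 * L k)) *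
    (expR (l k * Z k q w) + expR (- l k * Z k q w)))); last first.
    by rewrite lerDl sumr_ge0// => j _; rewrite mulr_ge0 ?addr_ge0 ?expR_ge0.
  rewrite addrC expRD ler_wpM2l ?expR_ge0//.
  have [z0|z0] := leP 0 (Z k q w).
    by rewrite ger0_norm// lerDl expR_ge0.
  by rewrite ltr0_norm// mulrN -mulNr lerDr expR_ge0.
have lZ : l k * `|Z k q w| <= A + 3 / 2 * L k.
  rewrite -lerBlDr -ler_expR /A lnK ?posrE ?ltr_pwDl//.
  by apply: le_trans expV _; rewrite lerDr.
rewrite -/(L k) -(ler_pM2l l0); apply: le_trans lZ _.
have -> : l k * (s k * (A + 2 * Num.sqrt (L k))) =
    Num.sqrt (L k) * A + 2 * (Num.sqrt (L k) ^+ 2).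
  by rewrite /l; field; rewrite gt_eqF.
rewrite sqr_sqrtr ?(le_trans ler01)//; nra.
Qed.

End SubgaussianFamily.

(** * Sufficiency: chaining along branches *)

Section SufficientCondition.
Variables (R : realType) (T : rootedTree) (alpha sigma : T -> R).
Hypothesis alpha_ge0 : forall t, 0 <= alpha t.
Hypothesis sigma_ge0 : forall t, 0 <= sigma t.
Hypothesis sigma_noninc : sigma_nonincreasing sigma.
Context (d : measure_display) (Om : measurableType d) (P : probability Om R).
Variable xi : T -> {RV P >-> R}.
Hypothesis xi_iid : iid_standard_normal xi.
Implicit Types (t s q : T) (k : nat).

Local Notation bd := (branch_dist alpha sigma).
Local Notation X := (tree_process alpha sigma xi).

Variables (N : nat -> seq T) (C : R).
Hypothesis N_gt0 : forall k, (0 < size (N k))%N.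
Hypothesis N_mono : forall j k, (j <= k)%N -> (size (N j) <= size (N k))%N.
Hypothesis N_net : forall k t,
  exists2 q, q \in N k & tree_le q t /\ bd q t < 2 * 2^-1 ^+ k.
Hypothesis N_entropy : forall K,
  \sum_(k < K) 2^-1 ^+ k.+1 * Num.sqrt (ln (size (N k))%:R) <= C.

(** Cumulative unions make the nets nested, on which [net_projS] rests. *)
Fixpoint net_union k : seq T :=
  if k is k'.+1 then net_union k' ++ N k else N 0%N.

Lemma size_net_union k : (0 < size (net_union k) <= k.+1 * size (N k))%N.
Proof.
elim: k => [|k /andP[U0 IH]]; first by rewrite mul1n leqnn N_gt0.
rewrite /= size_cat addn_gt0 U0 /= mulSn addnC leq_add2l.
by rewrite (leq_trans IH)// leq_mul2l N_mono ?orbT.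
Qed.

Lemma net_sub_union k : {subset N k <= net_union k}.
Proof. by case: k => [//|k] q qN; rewrite /= mem_cat qN orbT. Qed.

Lemma ex_net_proj k t : exists2 m, m \in net_union k /\ tree_le m t &
  forall q, q \in net_union k /\ tree_le q t -> tree_le q m.
Proof.
have [q qN [qt _]] := N_net k t.
apply: (@exists_tree_max _ (fun q => q \in net_union k /\ tree_le q t) t q).
  by move=> u [].
by split => //; exact: net_sub_union.
Qed.

Definition net_proj k t : T := sval (cid2 (ex_net_proj k t)).

Lemma net_projP k t : [/\ net_proj k t \in net_union k, tree_le (net_proj k t) t &
  forall q, q \in net_union k -> tree_le q t -> tree_le q (net_proj k t)].
Proof.
rewrite /net_proj; case: cid2 => m /= [mU mt] mmax.
by split => // q qU qt; exact: mmax.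
Qed.

(** The net point supplied by [N_net] lies below the projection, and the branch distance decreases
    as its start moves towards [t]. *)
Lemma net_proj_dist k t : bd (net_proj k t) t < 2 * 2^-1 ^+ k.
Proof.
have [q qN [qt]] := N_net k t; apply: le_lt_trans.
have [_ _ pmax] := net_projP k t.
apply: (branch_distS alpha sigma_ge0 sigma_noninc) (tree_le_refl t).
by apply: pmax => //; exact: net_sub_union.
Qed.

Lemma net_proj_le k t : tree_le (net_proj k t) (net_proj k.+1 t).
Proof.
have [pU pt _] := net_projP k t; have [_ _ pmax] := net_projP k.+1 t.
by apply: pmax => //; rewrite /= mem_cat pU.
Qed.

(** Consistency of the projections: a link of the chain is determined by its upper end, so level [k]
    has at most [size (net_union k.+1)] links. *)
Lemma net_projS k t : net_proj k (net_proj k.+1 t) = net_proj k t.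
Proof.
have [pU pt pmax] := net_projP k t; have [_ pt' _] := net_projP k.+1 t.
have [qU qp qmax] := net_projP k (net_proj k.+1 t).
apply: tree_le_anti.
  by apply: pmax => //; exact: tree_le_trans pt'.
by apply: qmax => //; exact: net_proj_le.
Qed.

(** The weight is [sigma q] rather than [sigma] at the final vertex, so the link depends on [q]
    alone; [chain_telescope] uses that [sigma] decreases. *)
Definition chain_link k q w : R :=
  sigma q * (\sum_(v \in branch_seg (net_proj k q) q) alpha v * xi v w).

Lemma measurable_chain_link k q : measurable_fun setT (chain_link k q).
Proof.
apply: measurable_funM => //.
under eq_fun do rewrite (fsbig_finite _ _ (finite_branch_seg _ _)).
by apply: measurable_sum => v; exact: measurable_funM.
Qed.

(** The link is a centred Gaussian whose standard deviation, [sigma q] times the segment length, is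
    at most the distance from the projection to [q]. *)
Lemma chain_link_subgaussian k q (l : R) :
  (\int[P]_w (expR (l * chain_link k q w))%:E <=
   (expR (l ^+ 2 * (2 * 2^-1 ^+ k) ^+ 2 / 2))%:E)%E.
Proof.
have [_ pq _] := net_projP k q.
set A := branch_seg (net_proj k q) q.
have fA : finite_set A by exact: finite_branch_seg.
have -> : (\int[P]_w (expR (l * chain_link k q w))%:E =
    \int[P]_w (expR (\sum_(v <- fset_set A) (l * sigma q * alpha v) * xi v w))%:E)%E.
  apply: eq_integral => w _; congr (expR _)%:E.
  rewrite /chain_link -/A (fsbig_finite _ _ fA) mulrA mulr_sumr.
  by apply: eq_bigr => v _; rewrite mulrA.
rewrite (gaussian_sum_mgf xi_iid); last exact: fset_uniq.
rewrite lee_fin ler_expR ler_wpM2r//.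
have -> : \sum_(v <- fset_set A) (l * sigma q * alpha v) ^+ 2 =
    l ^+ 2 * (sigma q * Num.sqrt (\sum_(v \in A) alpha v ^+ 2)) ^+ 2.
  rewrite (exprMn _ (sigma q)) sqr_sqrtr; last by apply: fsumr_ge0 => v _; exact: sqr_ge0.
  rewrite (fsbig_finite _ _ fA) mulrA mulr_sumr; apply: eq_bigr => v _.
  by rewrite !exprMn.
rewrite ler_wpM2l ?sqr_ge0// ler_sqr ?nnegrE ?mulr_ge0 ?sqrtr_ge0 ?exprn_ge0 ?invr_ge0//.
apply: le_trans (ltW (net_proj_dist k q)).
exact: branch_dist_ge_end.
Qed.

Lemma chain_telescope n t w :
  `|sigma t * (\sum_(v \in [set v | tree_le v (net_proj n t)]) alpha v * xi v w)| <=
  `|X (net_proj 0 t) w| + \sum_(k < n) `|chain_link k (net_proj k.+1 t) w|.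
Proof.
elim: n => [|n IH].
  rewrite big_ord0 addr0; apply: tree_process_ancestor_le => //.
  by have [] := net_projP 0 t.
rewrite (ancestor_sum_split _ (net_proj_le n t)) mulrDr big_ord_recr/= addrA.
apply: le_trans (ler_normD _ _) _; apply: lerD => //.
rewrite /chain_link net_projS !normrM ler_wpM2r// !ger0_norm//.
by apply: sigma_noninc; have [] := net_projP n.+1 t.
Qed.

(** Once the projection is close enough to [t], the missing segment carries no weight, so finitely
    many links give [X t] exactly. *)
Lemma chain_reaches t : exists n, forall w,
  X t w = sigma t * (\sum_(v \in [set v | tree_le v (net_proj n t)]) alpha v * xi v w).
Proof.
have [delta d0 dP] := short_branch_weight0 alpha_ge0 sigma_ge0 sigma_noninc t.
(* This gives [2 / delta < n.+1%:R <= 2 ^+ n], hence [2 * 2^-1 ^+ n <= delta]. *)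
pose n := Num.truncn (2 / delta); exists n => w.
have [_ pt _] := net_projP n t.
rewrite (tree_process_split _ _ _ _ pt) dP ?addr0//.
apply: lt_le_trans (net_proj_dist n t) _.
have h1 : 2 / delta < n.+1%:R by exact: truncnS_gt.
have h2 : n.+1%:R <= 2 ^+ n :> R by rewrite -natrX ler_nat ltn_expl.
rewrite exprVn ler_pdivrMr ?exprn_gt0//.
move: h1; rewrite ltr_pdivrMr// mulrC => h1.
by apply: le_trans (ltW h1) _; rewrite ler_pM2l.
Qed.

Lemma chain_weights_le n (A : R) : 0 <= A ->
  \sum_(k < n) (2 * 2^-1 ^+ k) *
    (A + 2 * Num.sqrt (ln (size (net_union k.+1))%:R + k.+1%:R)) <= 4 * A + 16 * C + 32.
Proof.
move=> A0; pose r k : R := Num.sqrt (ln (size (N k))%:R).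
have bnd k : Num.sqrt (ln (size (net_union k.+1))%:R + k.+1%:R) <= r k.+1 + 2 * k.+1%:R.
  have [U0 Ule] := andP (size_net_union k.+1).
  have lnN : 0 <= ln (size (N k.+1))%:R :> R by rewrite ln_ge0// ler1n.
  have k1 : 1 <= k.+1%:R :> R by rewrite ler1n.
  rewrite -[leRHS]ger0_norm ?addr_ge0 ?sqrtr_ge0 ?mulr_ge0// -sqrtr_sqr ler_wsqrtr//.
  (* The union has at most [k.+2] times the size of its last net, and [ln k.+2%:R <= k.+1%:R]. *)
  apply: (@le_trans _ _ (ln (size (N k.+1))%:R + k.+1%:R + k.+1%:R)).
    rewrite lerD2r; apply: (@le_trans _ _ (ln (k.+2%:R * (size (N k.+1))%:R))).
      rewrite ler_ln ?posrE ?mulr_gt0 ?ltr0n//.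
      by rewrite -natrM ler_nat.
    rewrite lnM ?posrE ?ltr0n// addrC lerD2l -natr1 addrC.
    by apply: le_ln1Dx; lra.
  rewrite sqrrD /r sqr_sqrtr//.
  have := mulr_ge0 (sqrtr_ge0 (ln (size (N k.+1))%:R)) (le_trans ler01 k1).
  by nra.
have r0 k : 0 <= r k := sqrtr_ge0 _.
have h0 k : 0 <= (2^-1 : R) ^+ k by rewrite exprn_ge0// invr_ge0.
(* The factor 16 turns [2^-1 ^+ k] into the [2^-1 ^+ k.+2] that accompanies [r k.+1] in the entropy
   sum; the other two parts are explicit convergent series. *)
apply: (@le_trans _ _ (\sum_(k < n) (4 * A * 2^-1 ^+ k.+1 +
    16 * (2^-1 ^+ k.+2 * r k.+1) + 8 * (k.+1%:R * 2^-1 ^+ k)))).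
  apply: ler_sum => k _.
  apply: (@le_trans _ _ (2 * 2^-1 ^+ k * (A + 2 * (r k.+1 + 2 * k.+1%:R)))).
    by rewrite ler_wpM2l ?mulr_ge0// lerD2l ler_pM2l.
  by rewrite !exprS; move: (2^-1 ^+ k) => h; lra.
rewrite !big_split/= -!mulr_sumr.
have := N_entropy n.+1; rewrite big_ord_recl/= => hC.
have hC' : \sum_(k < n) 2^-1 ^+ k.+2 * r k.+1 <= C.
  apply: le_trans hC; rewrite lerDr mulr_ge0//.
have := sum_geometric_half R n; have := sum_arith_geometric_half R n; nra.
Qed.

Lemma as_bounded_of_nets : as_bounded P X.
Proof.
have Ugt0 k : (0 < size (net_union k.+1))%N by have /andP[] := size_net_union k.+1.
have s0 k : 0 < 2 * (2^-1 : R) ^+ k by rewrite mulr_gt0// exprn_gt0// invr_gt0.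
have ae := subgaussian_family_bound Ugt0 s0 measurable_chain_link
  (fun k q _ => chain_link_subgaussian k q).
rewrite /as_bounded ereal_sup_levels.
set B := \bigcup_k _.
have mB : measurable B.
  apply: bigcupT_measurable => k.
  exact: measurable_le_level (countable_tree T) (measurable_tree_process alpha sigma xi).
suff : P (~` B) = 0%E.
  have PB : P B = (fine (P B))%:E by rewrite fineK// fin_num_measure.
  by rewrite probability_setC// PB -EFinB => -[h]; congr EFin; lra.
apply/negligibleP; first exact: measurableC.
apply: negligibleS ae => w /= nB [A A0 linkA]; apply: nB.
(* Every chain starts at a point of the finite list [N 0], so the first sum bounds all starting
   values. *)
pose M := \sum_(q <- N 0) `|X q w| + (4 * A + 16 * C + 32).
exists (Num.truncn M).+1 => // t.
apply: (@le_trans _ _ M); last by rewrite ltW// truncnS_gt.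
have [n ->] := chain_reaches t.
apply: le_trans (chain_telescope n t w) _; apply: lerD.
  have [pU _ _] := net_projP 0 t.
  rewrite (perm_big _ (perm_to_rem pU))/= big_cons lerDl sumr_ge0//.
apply: le_trans (chain_weights_le n A0); apply: ler_sum => k _.
apply: linkA; by have [] := net_projP k.+1 t.
Qed.

End SufficientCondition.

Theorem theorem1p1 (R : realType) (T : rootedTree) (alpha sigma : T -> R)
  (alpha_ge0 : forall t, 0 <= alpha t) (sigma_ge0 : forall t, 0 <= sigma t)
  (sigma_noninc : sigma_nonincreasing sigma)
  (d : measure_display) (Omega : measurableType d) (P : probability Omega R)
  (xi : T -> {RV P >-> R}) (xi_iid : iid_standard_normal xi) :
  ((\int[lebesgue_measure]_(eps in `]0%R, +oo[)
      sqrte (lne (covering_number (tree_dist alpha sigma) eps)) < +oo)%E ->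
   as_bounded P (tree_process alpha sigma xi)) /\
  (as_bounded P (tree_process alpha sigma xi) ->
   (ereal_sup
      [set eps%:E * sqrte (lne (covering_number (tree_dist alpha sigma) eps))
      | eps in [set eps : R | (0 < eps)%R]] < +oo)%E).
Proof.
split=> [entropy|Xbnd]; last exact: bounded_tree_entropy xi_iid Xbnd.
have [n [C [nP nmono nC]]] := entropy_integral_nets entropy.
have /choice[N NP] : forall k, exists N : seq T, size N = n k /\
    forall t, exists2 q, q \in N &
      tree_le q t /\ branch_dist alpha sigma q t < 2 * 2^-1 ^+ k.
  move=> k; have [_ [c cP]] := nP k.
  have [c' c'P] := order_net sigma_ge0 sigma_noninc cP.
  (* [codom] keeps repetitions, so the list has exactly [n k] entries. *)
  exists (codom c'); split=> [|t]; first by rewrite size_codom card_ord.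
  by have [i it ti] := c'P t; exists (c' i) => //; exact: codom_f.
have sN k : size (N k) = n k by have [] := NP k.
apply: (@as_bounded_of_nets _ _ _ _ alpha_ge0 sigma_ge0 sigma_noninc _ _ _ _ xi_iid N C).
- by move=> k; rewrite sN; have [] := nP k.
- by move=> j k jk; rewrite !sN nmono.
- by move=> k; have [_] := NP k.
- by move=> K; under eq_bigr do rewrite sN.
Qed.
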